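(* For every $\beta>1$ there are universal constants $C_1$ and $C_2$ depending only on $\beta$ such that the following holds. Let $u_0$ be a smooth divergence-free vector field on $\mathbb{R}^3$, periodic with period $1$ in each coordinate, $\omega_0=\nabla\wedge u_0$, and let $b(x,t)$, $t\ge0$, be a smooth time-dependent divergence-free vector field on $\mathbb{R}^3$, periodic with period $1$ in each coordinate of $x$, with $b(x,0)=u_0(x)$. Let $w(x,t)$ be the unique periodic solution of $$\partial_tw+(b\cdot\nabla)w-A(b)w-\tfrac12\Delta w=0,\qquad w(\cdot,0)=\omega_0.$$ Then $$|w(x,t)|\le C_1e^{C_2t\|b\|_\infty^2+2\sqrt t\,\|\nabla b\|_{0\to t}}\,G_{\beta t}(|\omega_0|)(x)\qquad\text{for all }t>0\text{ and }x\in\mathbb{T}^3.$$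
   Context: $\mathbb{T}^3=\mathbb{R}^3/\mathbb{Z}^3$; fields on $\mathbb{T}^3$ are identified with $1$-periodic fields on $\mathbb{R}^3$. $A(b)$ is the matrix field $A(b)_j^i=\partial_{x^j}b^i$, so $(A(b)w)^i=\sum_jw^j\partial_{x^j}b^i$. $G_t(x)=(2\pi t)^{-3/2}e^{-|x|^2/(2t)}$ and $G_t(f)(x)=\int_{\mathbb{R}^3}f(\xi)G_t(x-\xi)\,\mathrm{d}\xi$ for periodic $f$. $\|b\|_\infty=\sup_{\mathbb{R}^3\times[0,\infty)}|b|$ and $\|f\|_{0\to t}=\sup_{(x,s)\in\mathbb{R}^3\times[0,t]}|\sqrt s\,f(x,s)|$ (the bound is vacuous if $\|b\|_\infty=\infty$ and $\omega_0\not\equiv 0$). *)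

(* Defs.v *)
From HB Require Import structures.
From mathcomp Require Import all_boot all_order all_algebra.
From mathcomp Require Import all_classical all_reals all_analysis.

Set Implicit Arguments.
Unset Strict Implicit.
Unset Printing Implicit Defensive.

Import Order.TTheory GRing.Theory Num.Theory.
Import numFieldNormedType.Exports.

Local Open Scope classical_set_scope.
Local Open Scope ring_scope.

(* R^3 is 'rV[R]_3.  The norm `|x| of the library is the sup norm (which only
   serves to define the topology); the Euclidean norm is [norm2]. *)
Definition norm2 {R : realType} (x : 'rV[R]_3) : R :=
  Num.sqrt (\sum_(i < 3) x 0 i ^+ 2).

(* Operator norm of the matrix M acting on vectors by (M v)^i = sum_j M_ij v^j;
   it is at most the Frobenius norm of M. *)
Definition opnorm {R : realType} (M : 'M[R]_3) : R :=
  sup [set norm2 (v *m M^T) | v in [set v | norm2 v <= 1]].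

Definition partial {R : realType} (j : 'I_3) (f : 'rV[R]_3 -> R)
  : 'rV[R]_3 -> R := fun x => 'D_(delta_mx 0 j) f x.

Definition laplacian {R : realType} (f : 'rV[R]_3 -> R) (x : 'rV[R]_3) : R :=
  \sum_(j < 3) partial j (partial j f) x.

Definition divergence {R : realType} (u : 'rV[R]_3 -> 'rV[R]_3)
    (x : 'rV[R]_3) : R :=
  \sum_(i < 3) partial i (fun y => u y 0 i) x.

(* The additions on indices are those of the ring 'I_3, i.e. modulo 3. *)
Definition curl {R : realType} (u : 'rV[R]_3 -> 'rV[R]_3) (x : 'rV[R]_3)
  : 'rV[R]_3 :=
  \row_i (partial (i + 1) (fun y => u y 0 (i + 2)) x
          - partial (i + 2) (fun y => u y 0 (i + 1)) x).

Definition gradient_matrix {R : realType} (u : 'rV[R]_3 -> 'rV[R]_3)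
    (x : 'rV[R]_3) : 'M[R]_3 :=
  \matrix_(i, j) partial j (fun y => u y 0 i) x.

Definition unit_periodic {R : realType} {T : Type} (f : 'rV[R]_3 -> T) : Prop :=
  forall (i : 'I_3) (x : 'rV[R]_3), f (x + delta_mx 0 i) = f x.

(* [Ck n f]: f is of class C^n on V; on a finite-dimensional V, it amounts to
   the existence and continuity of all directional derivatives up to order n. *)
Fixpoint Ck {R : realType} {V : normedModType R} (n : nat) (f : V -> R)
  : Prop :=
  continuous f /\
  if n is m.+1 then
    forall v : V, (forall x, derivable f x v) /\ Ck m (fun x => 'D_v f x)
  else True.

Definition smooth {R : realType} {V : normedModType R} (f : V -> R) : Prop :=
  forall n, Ck n f.

Definition smooth_field {R : realType} (u : 'rV[R]_3 -> 'rV[R]_3) : Prop :=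
  forall i : 'I_3, smooth (fun x => u x 0 i).

(* Smoothness on the closed half-space t >= 0: as usual for a set which is not
   open, f has to be the restriction of a smooth function.  The values of the
   field at negative times are irrelevant. *)
Definition smooth_time_field {R : realType}
    (b : 'rV[R]_3 -> R -> 'rV[R]_3) : Prop :=
  forall i : 'I_3, exists2 B : 'rV[R]_3 * R -> R, smooth B &
    forall x t, 0 <= t -> b x t 0 i = B (x, t).

(* Continuous for t >= 0, of class C^1 in t and C^2 in x for t > 0. *)
Definition parabolic_regular {R : realType} (f : 'rV[R]_3 -> R -> R) : Prop :=
  {within [set p : 'rV[R]_3 * R | 0 <= p.2],
    continuous (fun p : 'rV[R]_3 * R => f p.1 p.2)} /\
  forall p : 'rV[R]_3 * R, 0 < p.2 ->
  [/\ derivable (f p.1) p.2 1 /\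
        {for p, continuous (fun q : 'rV[R]_3 * R => derive1 (f q.1) q.2)},
      forall j : 'I_3, derivable (f^~ p.2) p.1 (delta_mx 0 j) /\
        {for p, continuous (fun q : 'rV[R]_3 * R => partial j (f^~ q.2) q.1)}
    & forall j k : 'I_3,
        derivable (partial j (f^~ p.2)) p.1 (delta_mx 0 k) /\
        {for p, continuous
           (fun q : 'rV[R]_3 * R => partial k (partial j (f^~ q.2)) q.1)}].

(* w is a periodic classical solution of
     d_t w + (b . nabla) w - A(b) w - (1/2) Delta w = 0,  w(., 0) = w0,
   where A(b) = [gradient_matrix b]. *)
Record periodic_solution {R : realType} (b : 'rV[R]_3 -> R -> 'rV[R]_3)
    (w0 : 'rV[R]_3 -> 'rV[R]_3) (w : 'rV[R]_3 -> R -> 'rV[R]_3) : Prop := {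
  solution_regular : forall i : 'I_3, parabolic_regular (fun x t => w x t 0 i);
  solution_periodic : forall t, 0 <= t -> unit_periodic (w^~ t);
  solution_init : forall x, w x 0 = w0 x;
  solution_eq : forall x t, 0 < t -> forall i : 'I_3,
    derive1 (fun s => w x s 0 i) t
    + \sum_(j < 3) b x t 0 j * partial j (fun y => w y t 0 i) x
    - (w x t *m (gradient_matrix (b^~ t) x)^T) 0 i
    - 2^-1 * laplacian (fun y => w y t 0 i) x = 0
}.

Definition gauss {R : realType} (t : R) (x : 'rV[R]_3) : R :=
  (2 * pi * t) `^ (- (3 / 2)) * expR (- (norm2 x ^+ 2) / (2 * t)).

Definition vec3 {R : realType} (p : R * (R * R)) : 'rV[R]_3 :=
  \row_i tnth [tuple p.1; p.2.1; p.2.2] i.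

(* The integral over R^3 is taken against the product of three Lebesgue
   measures, through the identification [vec3] of R * (R * R) with R^3. *)
Definition gauss_conv {R : realType} (t : R) (f : 'rV[R]_3 -> R)
    (x : 'rV[R]_3) : \bar R :=
  (\int[lebesgue_measure \x (lebesgue_measure \x lebesgue_measure)]_p
     (f (vec3 p) * gauss t (x - vec3 p))%:E)%E.

Definition sup_norm {R : realType} (b : 'rV[R]_3 -> R -> 'rV[R]_3) : \bar R :=
  ereal_sup [set (norm2 (b p.1 p.2))%:E
            | p in [set p : 'rV[R]_3 * R | 0 <= p.2]].

Definition weighted_grad_norm {R : realType} (b : 'rV[R]_3 -> R -> 'rV[R]_3)
    (t : R) : \bar R :=
  ereal_sup [set (Num.sqrt p.2 * opnorm (gradient_matrix (b^~ p.2) p.1))%:E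
            | p in [set p : 'rV[R]_3 * R | 0 <= p.2 <= t]].

(* Main.v *)
Require Import Defs.
From HB Require Import structures.
From mathcomp Require Import all_boot all_order all_algebra.
From mathcomp Require Import all_classical all_reals all_analysis.
From mathcomp Require Import ring lra.

Import Order.TTheory GRing.Theory Num.Theory.
Import numFieldNormedType.Exports.

Local Open Scope classical_set_scope.
Local Open Scope ring_scope.

(* Let e be the unit vector along w at a point where |w| e^{-theta(s)} - U is
   positive and maximal.  The scalar e.w lies below |w| and touches it there, so
   the equation tested with e shows that U cannot be a strict supersolution of
   the scalar problem, whose zeroth order term |A(b)| <= K/sqrt s is absorbed by
   theta.  It remains to find U.  The Gaussian of variance sigma(s), centred at a
   point y, is a supersolution for every drift of size B up to a zeroth order term
   3(sigma'-1)/(2 sigma) + B^2/(2(sigma'-1)).  Taking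
   sigma(s) = eta + s + kappa s^{3/2}/sqrt T makes it integrable on [0,T], with
   integral at most 9 kappa/2 + 2 B^2 T/(3 kappa), while sigma(T) remains close
   to T.  A finite sum of such Gaussians on a lattice of mesh h = sqrt eta, plus
   a small multiple of 4T + B^2 T^2 + |x|^2 which controls the boundary of a
   large box, dominates the initial datum because the Gaussian centred in the
   cell of x is comparable to h^{-3} there.  At time T
   the sum is at most a constant times a lower Riemann sum of G_{beta T}(|w_0|),
   so neither differentiation under the integral sign nor an approximate identity
   is needed. *)

(** * Calculus *)

Section Calculus.
Context {R : realType}.

Section Pointwise.
Context {V : normedModType R}.
Implicit Types (f g : V -> R) (x v : V) (df dg c : R).

Lemma is_derive_addf f g x v df dg : is_derive x v f df -> is_derive x v g dg ->
  is_derive x v (fun y => f y + g y) (df + dg).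
Proof. exact: is_deriveD. Qed.

Lemma is_derive_subf f g x v df dg : is_derive x v f df -> is_derive x v g dg ->
  is_derive x v (fun y => f y - g y) (df - dg).
Proof. exact: is_deriveB. Qed.

Lemma is_derive_mulf f g x v df dg : is_derive x v f df -> is_derive x v g dg ->
  is_derive x v (fun y => f y * g y) (f x * dg + g x * df).
Proof. exact: is_deriveM. Qed.

Lemma is_derive_mull c f x v df : is_derive x v f df ->
  is_derive x v (fun y => c * f y) (c * df).
Proof. exact: is_deriveZ. Qed.

Lemma is_derive_sumf (I : finType) (h : I -> V -> R) x v (dh : I -> R) :
  (forall i, is_derive x v (h i) (dh i)) ->
  is_derive x v (fun y => \sum_i h i y) (\sum_i dh i).
Proof.
move=> dhi; suff -> : (fun y => \sum_i h i y) = \sum_i h i.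
  elim/big_ind2 : _ => // [|f1 d1 f2 d2 ? ?]; first exact: is_derive_cst.
  exact: is_deriveD.
by apply/funext => y; rewrite fct_sumE.
Qed.

(** The difference quotients agree before any limit is taken, so differentiability and the value of
    the derivative transfer together. Directional derivatives on R^3 thereby reduce to derivatives
    in one real variable, where the chain rule and the maximum tests below live. *)
Lemma line_quotient f x v (h : R) :
  (fun k : R => k^-1 *: (((fun l : R => f (x + l *: v)) \o shift h) (k *: (1 : R))
     - f (x + h *: v)))
  = (fun k : R => k^-1 *: ((f \o shift (x + h *: v)) (k *: v) - f (x + h *: v))).
Proof.
apply/funext => k /=; congr (_ *: (f _ - _)).
by rewrite [k *: 1]mulr1 scalerDl addrC -addrA [h *: v + _]addrC.
Qed.

Lemma is_derive_line f x v (h : R) df :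
  is_derive (x + h *: v) v f df <-> is_derive h (1:R) (fun k => f (x + k *: v)) df.
Proof.
split=> -[]; rewrite /derivable /derive.
  by rewrite -line_quotient => ? ?; split.
by rewrite line_quotient => ? ?; split.
Qed.

Lemma is_derive_line0 f x v df :
  is_derive x v f df <-> is_derive (0:R) (1:R) (fun k => f (x + k *: v)) df.
Proof. by rewrite -is_derive_line scale0r addr0. Qed.

End Pointwise.

Lemma is_derive_comp (F f : R -> R) (x dF df : R) : is_derive x 1 f df ->
  is_derive (f x) 1 F dF -> is_derive x 1 (fun y => F (f y)) (dF * df).
Proof. by move=> ? ?; exact: is_derive1_comp. Qed.

(** Only difference quotients from the left are used: in the application the maximum may sit at the
    final time, with no later times to compare with. *)
Lemma derivative_test_left_max (f : R -> R) (x df : R) :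
  is_derive x 1 f df -> (exists2 r : R, 0 < r & forall y, x - r < y <= x -> f y <= f x) ->
  0 <= df.
Proof.
move=> [fd <-] [r r0 fmax].
have cvl : h^-1 *: ((f \o shift x) (h *: 1) - f x) @[h --> 0^'-] --> 'D_1 f x.
  apply: cvg_trans fd; apply: cvg_app => A [e e0 Ae].
  by exists e => // y xe y0; apply: Ae => //; exact: ltr0_neq0.
apply: (cvgr_to_ge cvl).
near=> h; apply: mulr_le0.
  by rewrite invr_le0 ltW.
rewrite subr_le0 /= [h *: 1]mulr1; apply: fmax.
have h0 : h < 0 by near: h; exact: nbhs_left_lt.
have hr : - r < h by near: h; apply: nbhs_left_gt; rewrite oppr_lt0.
by apply/andP; split; lra.
Unshelve. all: by end_near. Qed.

(** If [p2] were positive, [p1], which vanishes at 0, would be positive just to the right of 0, and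
    the mean value theorem would lift [p] above [p 0]. *)
Lemma second_derivative_test (p p1 : R -> R) (p2 : R) :
  (forall h : R, is_derive h 1 p (p1 h)) -> is_derive (0 : R) 1 p1 p2 ->
  (exists2 r : R, 0 < r & forall h, `|h| < r -> p h <= p 0) ->
  p1 0 = 0 /\ p2 <= 0.
Proof.
move=> dp dp1 [r r0 pmax].
have p10 : p1 0 = 0.
  have : is_derive (0:R) 1 p 0.
    apply: (@derive1_at_max R p (- r) r); [lra| |by rewrite in_itv /=; lra|].
      by move=> t _; have [] := dp t.
    by move=> t; rewrite in_itv /= => /andP[? ?]; apply: pmax; rewrite ltr_norml; lra.
  by move=> d0; have := @derive_val _ _ _ _ _ _ _ d0; rewrite (@derive_val _ _ _ _ _ _ _ (dp 0)).
split=> //; rewrite leNgt; apply/negP => p2_gt0.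
have [dp1d dp1E] := dp1.
have : \forall h \near 0^'+, 0 < h^-1 * p1 h.
  have cvp : h^-1 *: ((p1 \o shift 0) (h *: 1) - p1 0) @[h --> 0^'+] --> p2.
    rewrite -dp1E; apply: cvg_trans dp1d => //.
    apply: cvg_app => A [e e0 Ae].
    by exists e => // y xe y0; apply: Ae => //; exact: lt0r_neq0.
  have /cvgr_gt/(_ _ p2_gt0) := cvp.
  apply: filterS => h /=.
  by rewrite p10 subr0 addr0 [h *: 1]mulr1.
rewrite near_withinE near_nbhs => -[e /= e0 He].
pose h := Num.min e r / 2.
have m0 : 0 < Num.min e r by rewrite lt_min e0.
have h0 : 0 < h by rewrite /h; lra.
have he : h < e by apply: lt_le_trans (_ : Num.min e r <= e); rewrite /h ?ge_min ?lexx//; lra.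
have hr : h < r by apply: lt_le_trans (_ : Num.min e r <= r); rewrite /h ?ge_min ?lexx ?orbT//; lra.
have [c ch pE] := @MVT R p p1 0 h h0 (fun x _ => dp x)
  (derivable_within_continuous (fun x _ => @ex_derive _ _ _ _ _ _ _ (dp x))).
move: ch; rewrite in_itv /= => /andP[c0 ch].
have : 0 < c^-1 * p1 c.
  by apply: He => //=; rewrite sub0r normrN gtr0_norm//; lra.
rewrite pmulr_rgt0 ?invr_gt0// => p1c.
have := pmax h; rewrite gtr0_norm// => /(_ hr).
have : 0 < p1 c * (h - 0) by rewrite mulr_gt0// subr0.
lra.
Qed.

End Calculus.

(** * Euclidean norm *)

Section EuclideanNorm.
Context {R : realType}.
Implicit Types (u v x y : 'rV[R]_3) (M : 'M[R]_3).

Lemma sum3E (V : nmodType) (F : 'I_3 -> V) :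
  \sum_(i < 3) F i = F 0 + F 1 + F 2%:R.
Proof.
rewrite !big_ord_recr big_ord0 /= add0r.
by congr (F _ + F _ + F _); apply: val_inj.
Qed.

Lemma norm2_ge0 x : 0 <= norm2 x. Proof. exact: sqrtr_ge0. Qed.

Lemma norm2_sqr x : norm2 x ^+ 2 = \sum_i x 0 i ^+ 2.
Proof. by rewrite sqr_sqrtr// sumr_ge0// => i _; exact: sqr_ge0. Qed.

Lemma norm2_0 : norm2 (0 : 'rV[R]_3) = 0.
Proof. by rewrite /norm2 big1 ?sqrtr0// => i _; rewrite mxE expr0n. Qed.

Lemma norm2_eq0 x : norm2 x = 0 -> x = 0.
Proof.
move=> nx0; have := norm2_sqr x; rewrite nx0 expr0n /= => /esym/eqP.
rewrite psumr_eq0 => [/allP xi0|i _]; last exact: sqr_ge0.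
apply/rowP => i; rewrite mxE; apply/eqP.
by have := xi0 i; rewrite mem_index_enum sqrf_eq0 => /(_ isT).
Qed.

Lemma norm2Z (c : R) x : norm2 (c *: x) = `|c| * norm2 x.
Proof.
rewrite /norm2 -sqrtr_sqr -sqrtrM ?sqr_ge0// mulr_sumr.
by congr Num.sqrt; apply: eq_bigr => i _; rewrite mxE exprMn.
Qed.

Lemma norm2_le_sum x : norm2 x <= \sum_i `|x 0 i|.
Proof.
have s0 : 0 <= \sum_i `|x 0 i| by apply: sumr_ge0.
rewrite -(ler_pXn2r (n := 2)) ?nnegrE ?norm2_ge0// norm2_sqr !sum3E.
rewrite -!(real_normK (num_real (x 0 _))).
have := normr_ge0 (x 0 0); have := normr_ge0 (x 0 1); have := normr_ge0 (x 0 2%:R).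
nra.
Qed.

Lemma coord_le_norm2 x i : `|x 0 i| <= norm2 x.
Proof.
rewrite -(ler_pXn2r (n := 2)) ?nnegrE ?norm2_ge0// norm2_sqr real_normK ?num_real//.
by rewrite (bigD1 i)//= lerDl sumr_ge0// => j _; exact: sqr_ge0.
Qed.

(** Lagrange's identity: the defect in the squared Cauchy-Schwarz inequality is the squared length
    of the cross product. *)
Lemma dot_le_norm2 u v : \sum_i u 0 i * v 0 i <= norm2 u * norm2 v.
Proof.
apply: le_trans (ler_norm _) _.
rewrite -(ler_pXn2r (n := 2)) ?nnegrE ?mulr_ge0 ?norm2_ge0//.
rewrite exprMn !norm2_sqr real_normK ?num_real// !sum3E.
move: (u 0 0) (u 0 1) (u 0 2%:R) (v 0 0) (v 0 1) (v 0 2%:R) => a b c a' b' c'.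
rewrite -subr_ge0.
have -> : (a ^+ 2 + b ^+ 2 + c ^+ 2) * (a' ^+ 2 + b' ^+ 2 + c' ^+ 2)
  - (a * a' + b * b' + c * c') ^+ 2
  = (a * b' - b * a') ^+ 2 + (a * c' - c * a') ^+ 2 + (b * c' - c * b') ^+ 2 by ring.
by rewrite !addr_ge0 ?sqr_ge0.
Qed.

Lemma norm2_mulmx_le M v : norm2 v <= 1 ->
  norm2 (v *m M^T) <= \sum_i \sum_j `|M i j|.
Proof.
move=> v1; apply: le_trans (norm2_le_sum _) _; apply: ler_sum => i _.
rewrite mxE; apply: le_trans (ler_norm_sum _ _ _) _; apply: ler_sum => j _.
rewrite mxE normrM ler_piMl//; exact: le_trans (coord_le_norm2 _ _) v1.
Qed.

(** Needed because [sup] takes a default value on unbounded sets, in which case [opnorm] would bound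
    nothing. *)
Lemma opnorm_has_sup M :
  has_sup [set norm2 (v *m M^T) | v in [set v | norm2 v <= 1]].
Proof.
split.
  by exists (norm2 (0 *m M^T)); exists 0 => //=; rewrite norm2_0 ler01.
by exists (\sum_i \sum_j `|M i j|) => _ [v v1 <-]; exact: norm2_mulmx_le.
Qed.

Lemma opnorm_ge0 M : 0 <= opnorm M.
Proof.
have [_ ub] := opnorm_has_sup M.
apply: le_trans (norm2_ge0 (0 *m M^T)) _; apply: ub_le_sup => //.
by exists 0 => //=; rewrite norm2_0 ler01.
Qed.

Lemma opnorm_le_sum M : opnorm M <= \sum_i \sum_j `|M i j|.
Proof.
apply: ge_sup; first by have [] := opnorm_has_sup M.
by move=> _ [v v1 <-]; exact: norm2_mulmx_le.
Qed.

Lemma norm2_mulmx_opnorm M v : norm2 (v *m M^T) <= opnorm M * norm2 v.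
Proof.
have [v0|v0] := eqVneq (norm2 v) 0.
  by rewrite v0 mulr0 (norm2_eq0 _ v0) mul0mx norm2_0.
have vp : 0 < norm2 v by rewrite lt_neqAle eq_sym v0 norm2_ge0.
have [_ ub] := opnorm_has_sup M.
rewrite -ler_pdivrMr//.
have -> : norm2 (v *m M^T) / norm2 v = norm2 (((norm2 v)^-1 *: v) *m M^T).
  by rewrite -scalemxAl norm2Z ger0_norm ?invr_ge0 ?norm2_ge0// mulrC.
apply: ub_le_sup => //; exists ((norm2 v)^-1 *: v) => //=.
by rewrite norm2Z ger0_norm ?invr_ge0 ?norm2_ge0// mulVf.
Qed.

End EuclideanNorm.

(** * Maximum principle *)

Section MaxPrinciple.
Context {R : realType}.

Lemma compact_box (r T : R) :
  compact [set p : 'rV[R]_3 * R | (forall i, `|p.1 0 i| <= r) /\ 0 <= p.2 <= T].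
Proof.
have -> : [set p : 'rV[R]_3 * R | (forall i, `|p.1 0 i| <= r) /\ 0 <= p.2 <= T]
  = [set x : 'rV[R]_3 | forall i, `[- r, r]%classic (x ord0 i)] `*` `[0, T].
  apply/seteqP; split => -[x s] /= [xr sT]; split=> //.
  - by move=> i; rewrite in_itv /= -ler_norml; exact: xr.
  - by move=> i; have : x 0 i \in `[- r, r] := xr i; rewrite in_itv /= -ler_norml.
apply: compact_setX; last exact: segment_compact.
by apply: (@rV_compact _ 3 (fun=> `[- r, r]%classic)) => i; exact: segment_compact.
Qed.

(** Testing the system with a fixed vector e gives a scalar equation for e.w. Stated for bare
    families of numbers, it is a polynomial identity. *)
Lemma contract_equation (e d B g : 'I_3 -> R) (p q : 'I_3 -> 'I_3 -> R) :
  (forall i, d i + \sum_j B j * p i j - g i - 2^-1 * \sum_j q i j = 0) ->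
  \sum_i e i * d i + \sum_j B j * (\sum_i e i * p i j) - \sum_i e i * g i
    - 2^-1 * \sum_j \sum_i e i * q i j = 0.
Proof.
move=> eqn; transitivity (\sum_i e i *
    (d i + \sum_j B j * p i j - g i - 2^-1 * \sum_j q i j)).
  by rewrite !sum3E; ring.
by rewrite big1// => i _; rewrite eqn mulr0.
Qed.

Lemma parabolic_regular_line (f : 'rV[R]_3 -> R -> R) x (s : R) j :
  parabolic_regular f -> 0 < s ->
  [/\ is_derive s 1 (f x) (derive1 (f x) s),
      is_derive x (delta_mx 0 j) (f^~ s) (partial j (f^~ s) x) &
      is_derive x (delta_mx 0 j) (partial j (f^~ s)) (partial j (partial j (f^~ s)) x)].
Proof.
move=> [_ freg] s0; have [[ft _] fj fjj] := freg (x, s) s0.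
split.
- by rewrite derive1E; exact: derivableP.
- by apply: derivableP; have [] := fj j.
- by apply: derivableP; have [] := fjj j j.
Qed.

(** The derivatives of the barrier are supplied as data. Differential hypotheses are confined to 0 <
    s because [th] will contain sqrt s; time 0 enters through continuity on the closed box and
    through the comparison on the initial slice and the lateral faces. *)
Lemma weighted_maximum_principle (b w : 'rV[R]_3 -> R -> 'rV[R]_3)
    (w0 : 'rV[R]_3 -> 'rV[R]_3) (r T : R) (a th dth : R -> R)
    (U Us : 'rV[R]_3 -> R -> R) (Uj Ujj : 'I_3 -> 'rV[R]_3 -> R -> R) :
  periodic_solution b w0 w ->
  {within [set p : 'rV[R]_3 * R | (forall i, `|p.1 0 i| <= r) /\ 0 <= p.2 <= T],
    continuous (fun p => expR (- th p.2) * norm2 (w p.1 p.2) - U p.1 p.2)} ->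
  (forall (x : 'rV[R]_3) (s : R), (forall i, `|x 0 i| <= r) -> 0 < s <= T ->
    opnorm (gradient_matrix (b^~ s) x) <= a s) ->
  (forall s : R, 0 < s <= T -> is_derive s 1 th (dth s)) ->
  (forall s : R, 0 < s <= T -> a s <= dth s) ->
  (forall (x : 'rV[R]_3) (s : R), 0 < s <= T -> 0 <= U x s) ->
  (forall (x : 'rV[R]_3) (s : R), 0 < s <= T -> is_derive s 1 (U x) (Us x s)) ->
  (forall j (x : 'rV[R]_3) (s : R), 0 < s <= T -> is_derive x (delta_mx 0 j) (U^~ s) (Uj j x s)) ->
  (forall j (x : 'rV[R]_3) (s : R), 0 < s <= T ->
    is_derive x (delta_mx 0 j) (Uj j ^~ s) (Ujj j x s)) ->
  (forall (x : 'rV[R]_3) (s : R), (forall i, `|x 0 i| <= r) -> 0 < s <= T ->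
    0 < Us x s + \sum_j b x s 0 j * Uj j x s - 2^-1 * \sum_j Ujj j x s
        + (dth s - a s) * U x s) ->
  (forall (x : 'rV[R]_3) (s : R), (forall i, `|x 0 i| <= r) -> 0 <= s <= T ->
    s = 0 \/ (exists i, `|x 0 i| = r) -> expR (- th s) * norm2 (w x s) <= U x s) ->
  forall (x : 'rV[R]_3) (s : R), (forall i, `|x 0 i| <= r) -> 0 <= s <= T ->
    expR (- th s) * norm2 (w x s) <= U x s.
Proof.
move=> [wreg _ _ weq] Dcont ab dthP adth U0 dU dUj dUjj super bdry x1 s1 x1r s1T.
have [x [s [xr sT Dmax]]] : exists (x : 'rV[R]_3) (s : R), [/\
    forall i, `|x 0 i| <= r, 0 <= s <= T &
    forall (y : 'rV[R]_3) (z : R), (forall i, `|y 0 i| <= r) -> 0 <= z <= T ->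
      expR (- th z) * norm2 (w y z) - U y z <= expR (- th s) * norm2 (w x s) - U x s].
  have [|[x s]] := compact_EVT_max _ (compact_box r T) Dcont; first by exists (x1, s1).
  rewrite inE /= => -[xr sT] Dmax; exists x, s; split=> // y z yr zT.
  by apply: (Dmax (y, z)); rewrite inE.
rewrite -subr_le0; apply: le_trans (_ : expR (- th s) * norm2 (w x s) - U x s <= 0).
  exact: Dmax.
rewrite leNgt; apply/negP => Dpos.
have nbd : ~ (s = 0 \/ exists i, `|x 0 i| = r).
  by move=> /(bdry x s xr sT); rewrite -subr_le0 leNgt Dpos.
have s0 : 0 < s.
  by move/andP: sT => [s0 _]; rewrite lt_neqAle s0 andbT eq_sym; apply/eqP => s00; apply: nbd; left.
have sT' : 0 < s <= T by rewrite s0; move/andP: sT => [].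
have xr' i : `|x 0 i| < r.
  by rewrite lt_neqAle xr andbT; apply/eqP => xi; apply: nbd; right; exists i.
set E := expR (- th s) in Dpos *.
have E0 : 0 < E by exact: expR_gt0.
have dE : is_derive s 1 (fun y => expR (- th y)) (E * - dth s).
  apply: (is_derive_comp expR (fun y => - th y)).
  exact: is_deriveN (dthP s sT').
set W := norm2 (w x s) in Dpos *.
(* Where w vanishes, U >= 0 already contradicts the positive maximum, so dividing by W is legitimate
   afterwards. *)
have [W0|W0] : W = 0 \/ 0 < W.
  by have := norm2_ge0 (w x s); rewrite le_eqVlt => /orP[/eqP|]; [left|right].
  by move: Dpos; rewrite W0 mulr0 sub0r oppr_gt0 ltNge U0.
(* the unit vector along w (x, s) linearizes |w| at the maximum *)
pose e i := W^-1 * w x s 0 i.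
pose phi (y : 'rV[R]_3) (z : R) := \sum_i e i * w y z 0 i.
have phi_e (y : 'rV[R]_3) : \sum_i e i * y 0 i = W^-1 * \sum_i w x s 0 i * y 0 i.
  by rewrite mulr_sumr; apply: eq_bigr => i _; rewrite mulrA.
have e_le (y : 'rV[R]_3) : \sum_i e i * y 0 i <= norm2 y.
  by rewrite phi_e mulrC ler_pdivrMr// mulrC; exact: dot_le_norm2.
have phi_le (y : 'rV[R]_3) (z : R) : phi y z <= norm2 (w y z) by exact: e_le.
have phiE : phi x s = W.
  rewrite /phi phi_e; have -> : \sum_i w x s 0 i * w x s 0 i = W ^+ 2 by rewrite norm2_sqr.
  by rewrite expr2 mulKf// gt_eqF.
have phix j (y : 'rV[R]_3) : is_derive y (delta_mx 0 j) (phi^~ s)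
    (\sum_i e i * partial j (fun y => w y s 0 i) y).
  apply: is_derive_sumf => i; apply: is_derive_mull.
  by have [_ ? _] := parabolic_regular_line _ y s j (wreg i) s0.
have phixx j (y : 'rV[R]_3) : is_derive y (delta_mx 0 j)
    (fun y => \sum_i e i * partial j (fun y => w y s 0 i) y)
    (\sum_i e i * partial j (partial j (fun y => w y s 0 i)) y).
  apply: is_derive_sumf => i; apply: is_derive_mull.
  by have [_ _ ?] := parabolic_regular_line _ y s j (wreg i) s0.
have phis : is_derive s 1 (phi x) (\sum_i e i * derive1 (fun z => w x z 0 i) s).
  apply: is_derive_sumf => i; apply: is_derive_mull.
  by have [? _ _] := parabolic_regular_line _ x s 0 (wreg i) s0.
(* Since phi <= |w| with equality at (x, s), replacing |w| by the differentiable phi keeps the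
   maximum at the same point. *)
have Dmax' (y : 'rV[R]_3) (z : R) : (forall i, `|y 0 i| <= r) -> 0 <= z <= T ->
    expR (- th z) * phi y z - U y z <= E * phi x s - U x s.
  move=> yr zT; rewrite phiE; apply: le_trans (_ : expR (- th z) * norm2 (w y z) - U y z <= _).
    by rewrite lerD2r ler_wpM2l// expR_ge0.
  exact: Dmax.
have space j :
    E * (\sum_i e i * partial j (fun y => w y s 0 i) x) = Uj j x s /\
    E * (\sum_i e i * partial j (partial j (fun y => w y s 0 i)) x) <= Ujj j x s.
  pose X k : 'rV[R]_3 := x + k *: delta_mx 0 j.
  have X0 : X 0 = x by rewrite /X scale0r addr0.
  have [|||] := @second_derivative_test R
    (fun k => E * phi (X k) s - U (X k) s)
    (fun k => E * (\sum_i e i * partial j (fun y => w y s 0 i) (X k)) - Uj j (X k) s)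
    (E * (\sum_i e i * partial j (partial j (fun y => w y s 0 i)) x) - Ujj j x s).
  - move=> k; apply: (is_derive_line (fun y => E * phi y s - U y s) x _ k _).1.
    exact: (is_derive_subf _ _ _ _ _ _ (is_derive_mull _ _ _ _ _ (phix j _)) (dUj j _ s sT')).
  - apply: (is_derive_line0 (fun y =>
      E * (\sum_i e i * partial j (fun y => w y s 0 i) y) - Uj j y s) x _ _).1.
    exact: (is_derive_subf _ _ _ _ _ _ (is_derive_mull _ _ _ _ _ (phixx j _)) (dUjj j _ s sT')).
  (* This radius keeps the segment in direction j inside the box. *)
  - exists (r - `|x 0 j|); first by rewrite subr_gt0.
    move=> k kr; rewrite X0; apply: Dmax' => //= i.
    rewrite !mxE eqxx /=; case: eqVneq => [->|_]; last by rewrite mulr0 addr0.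
    by rewrite mulr1; apply: le_trans (ler_normD _ _) _; lra.
  - by rewrite X0 => /eqP; rewrite subr_eq0 => /eqP ? ?; split=> //; rewrite -subr_le0.
have time : 0 <= E * (\sum_i e i * derive1 (fun z => w x z 0 i) s)
    + phi x s * (E * - dth s) - Us x s.
  apply: (@derivative_test_left_max R (fun z => expR (- th z) * phi x z - U x z) s).
    exact: (is_derive_subf _ _ _ _ _ _ (is_derive_mulf _ _ _ _ _ _ dE phis) (dU x s sT')).
  exists s => // y; rewrite subrr => /andP[y0 ys].
  apply: Dmax' => //; rewrite (ltW y0) /=.
  by move/andP: sT => [_]; exact: le_trans.
have eqn : \sum_i e i * derive1 (fun z => w x z 0 i) s
   + \sum_j b x s 0 j * (\sum_i e i * partial j (fun y => w y s 0 i) x)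
   - \sum_i e i * (w x s *m (gradient_matrix (b^~ s) x)^T) 0 i
   - 2^-1 * \sum_j \sum_i e i * partial j (partial j (fun y => w y s 0 i)) x = 0.
  apply: contract_equation => i; exact: weq x s s0 i.
have stretch : \sum_i e i * (w x s *m (gradient_matrix (b^~ s) x)^T) 0 i <= a s * W.
  apply: le_trans (e_le _) _; apply: le_trans (norm2_mulmx_opnorm _ _) _.
  by rewrite ler_wpM2r ?norm2_ge0// ab.
have := super x s xr sT'.
have EsumU : \sum_j b x s 0 j * Uj j x s
   = E * \sum_j b x s 0 j * (\sum_i e i * partial j (fun y => w y s 0 i) x).
  by rewrite mulr_sumr; apply: eq_bigr => j _; rewrite -(space j).1 mulrCA.
have EsumUU : E * (\sum_j \sum_i e i * partial j (partial j (fun y => w y s 0 i)) x)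
   <= \sum_j Ujj j x s.
  by rewrite mulr_sumr; apply: ler_sum => j _; exact: (space j).2.
(* Here E W > U and [a] <= [dth] allow U to be replaced by E W in the zeroth order term. The
   contracted equation times E then makes the supersolution expression nonpositive, a
   contradiction. *)
have : (dth s - a s) * U x s <= (dth s - a s) * (E * W).
  by apply: ler_wpM2l; [rewrite subr_ge0 adth|rewrite ltW// -subr_gt0].
move: eqn time stretch EsumU EsumUU; rewrite phiE.
set S1 := \sum_i e i * derive1 _ _.
set S2 := \sum_j b x s 0 j * (\sum_i _).
set S3 := \sum_i e i * (_ *m _) _ _.
set S4 := \sum_j \sum_i _.
move: (\sum_j Ujj j x s) (\sum_j b x s 0 j * Uj j x s) => V4 V2.
move=> eqn time stretch -> V4le Ule.
have : E * S3 <= E * (a s * W) by rewrite ler_pM2l.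
clearbody S1 S2 S3 S4 W E.
have S1E : S1 = - S2 + S3 + 2^-1 * S4 by lra.
rewrite S1E in time.
lra.
Qed.

End MaxPrinciple.

(** * Spreading Gaussians *)

Section Barrier.
Context {R : realType}.
Variables (eta kappa T : R).
Hypotheses (eta_gt0 : 0 < eta) (kappa_gt0 : 0 < kappa) (T_gt0 : 0 < T).

(** The excess sigma' - 1 is proportional to sqrt s. Both (sigma' - 1)/sigma and B^2/(sigma' - 1)
    are then O(s^{-1/2}), the same integrable singularity as in the gradient bound; [eta] keeps the
    kernel regular at time 0. *)
Definition variance (s : R) : R :=
  eta + s + kappa / Num.sqrt T * (s * Num.sqrt s).

Definition dvariance (s : R) : R := 1 + 3 / 2 * kappa * Num.sqrt s / Num.sqrt T.

Lemma sqrtT_gt0 : 0 < Num.sqrt T. Proof. by rewrite sqrtr_gt0. Qed.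

Lemma variance_ge (s : R) : 0 <= s -> eta + s <= variance s.
Proof.
by move=> s0; rewrite lerDl mulr_ge0 ?divr_ge0 ?mulr_ge0 ?sqrtr_ge0// ltW.
Qed.

Lemma variance_gt0 (s : R) : 0 <= s -> 0 < variance s.
Proof. by move=> s0; apply: lt_le_trans (variance_ge s s0); rewrite ltr_wpDr. Qed.

Lemma variance0 : variance 0 = eta.
Proof. by rewrite /variance mul0r mulr0 !addr0. Qed.

Lemma variance_end : variance T = eta + (1 + kappa) * T.
Proof.
rewrite /variance.
by have := sqrtT_gt0; move: (Num.sqrt T) => t t0; field; rewrite gt_eqF.
Qed.

Lemma is_derive_variance (s : R) : 0 < s -> is_derive s 1 variance (dvariance s).
Proof.
move=> s0; have r0 : 0 < Num.sqrt s by rewrite sqrtr_gt0.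
have := is_derive_addf _ _ _ _ _ _ (is_derive_addf _ _ _ _ _ _
  (is_derive_cst eta s 1) (is_derive_id s 1))
  (is_derive_mull (kappa / Num.sqrt T) _ _ _ _
  (is_derive_mulf _ _ _ _ _ _ (is_derive_id s 1) (is_derive1_sqrt s0))).
move/is_derive_eq; apply; rewrite /dvariance add0r mulr1.
congr (_ + _).
have := sqrtT_gt0; have := sqr_sqrtr (ltW s0).
move: (Num.sqrt T) (Num.sqrt s) r0 => t r r0 <- t0.
by field; rewrite !gt_eqF.
Qed.

Lemma continuous_variance : continuous variance.
Proof.
move=> s; apply: cvgD; first by apply: cvgD; [exact: cvg_cst|exact: cvg_id].
apply: cvgM; first exact: cvg_cst.
by apply: cvgM; [exact: cvg_id|exact: sqrt_continuous].
Qed.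

(** The centred Gaussian without its factor (2 pi)^{-3/2}. The power of the variance sits in the
    exponent, so that comparisons of kernels become comparisons of exponents. *)
Definition kernel (y x : 'rV[R]_3) (s : R) : R :=
  expR (- (3 / 2) * ln (variance s) - norm2 (x - y) ^+ 2 / (2 * variance s)).

Lemma kernel_gt0 y x s : 0 < kernel y x s. Proof. exact: expR_gt0. Qed.

Definition kernel_t (y x : 'rV[R]_3) (s : R) : R :=
  kernel y x s * (- (3 / 2) * (dvariance s / variance s)
    + norm2 (x - y) ^+ 2 * dvariance s / (2 * variance s ^+ 2)).

Definition kernel_x (y : 'rV[R]_3) (j : 'I_3) (x : 'rV[R]_3) (s : R) : R :=
  - (x - y) 0 j / variance s * kernel y x s.

Definition kernel_xx (y : 'rV[R]_3) (j : 'I_3) (x : 'rV[R]_3) (s : R) : R :=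
  ((x - y) 0 j ^+ 2 / variance s ^+ 2 - (variance s)^-1) * kernel y x s.

Lemma is_derive_kernel_t (y x : 'rV[R]_3) (s : R) : 0 < s ->
  is_derive s 1 (kernel y x) (kernel_t y x s).
Proof.
move=> s0; have v0 := variance_gt0 s (ltW s0).
have dv := is_derive_variance s s0.
have dl := is_derive_comp _ _ _ _ _ dv (is_derive1_ln v0).
have d2 := is_derive_mull 2 _ _ _ _ dv.
have v20 : 2 * variance s != 0 by rewrite mulf_neq0// gt_eqF.
have di := @is_deriveV R (fun s => 2 * variance s) s _ 1 v20 d2.
have := is_derive_comp expR _ _ _ _ (is_derive_subf _ _ _ _ _ _
  (is_derive_mull (- (3 / 2)) _ _ _ _ dl)
  (is_derive_mull (norm2 (x - y) ^+ 2) _ _ _ _ di)) (is_derive_expR _).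
move/is_derive_eq; apply; rewrite /kernel_t /kernel; congr (_ * _).
move: (norm2 _) (dvariance _) => n d.
move: v0; move: (variance s) => v v0.
by rewrite /GRing.scale /=; field; rewrite gt_eqF.
Qed.

Lemma norm2_line (z : 'rV[R]_3) j (k : R) :
  norm2 (z + k *: delta_mx 0 j) ^+ 2 = norm2 z ^+ 2 + 2 * k * z 0 j + k ^+ 2.
Proof.
rewrite !norm2_sqr.
have E i : (z + k *: delta_mx 0 j) 0 i ^+ 2 = z 0 i ^+ 2 +
    (if i == j then 2 * k * z 0 j + k ^+ 2 else 0).
  rewrite !mxE eqxx /=; case: eqVneq => [->|_]; first by rewrite mulr1; ring.
  by rewrite mulr0 !addr0.
under eq_bigr do rewrite E.
by rewrite big_split /= -big_mkcond big_pred1_eq addrA.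
Qed.

Lemma is_derive_norm2_sqr (y x : 'rV[R]_3) j :
  is_derive x (delta_mx 0 j) (fun x => norm2 (x - y) ^+ 2) (2 * (x - y) 0 j).
Proof.
apply/is_derive_line0.
have -> : (fun k => norm2 (x + k *: delta_mx 0 j - y) ^+ 2)
    = (fun k => norm2 (x - y) ^+ 2 + (2 * (x - y) 0 j * k + k * k)).
  by apply/funext => k; rewrite addrAC norm2_line; ring.
have dk : is_derive (0:R) 1 (fun k : R => k) 1 by exact: is_derive_id.
have := is_derive_addf _ _ _ _ _ _ (is_derive_cst (norm2 (x - y) ^+ 2) (0:R) 1)
  (is_derive_addf _ _ _ _ _ _ (is_derive_mull (2 * (x - y) 0 j) _ _ _ _ dk)
    (is_derive_mulf _ _ _ _ _ _ dk dk)).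
by move/is_derive_eq; apply; ring.
Qed.

Lemma is_derive_coord (x : 'rV[R]_3) i j :
  is_derive x (delta_mx 0 j) (fun x => x 0 i) (i == j)%:R.
Proof.
apply/is_derive_line0.
have -> : (fun k => (x + k *: delta_mx 0 j) 0 i)
    = (fun k => x 0 i + (i == j)%:R * k).
  by apply/funext => k; rewrite !mxE eqxx /= mulrC.
have dk : is_derive (0:R) 1 (fun k : R => k) 1 by exact: is_derive_id.
have := is_derive_addf _ _ _ _ _ _ (is_derive_cst (x 0 i) (0:R) 1)
  (is_derive_mull (i == j)%:R _ _ _ _ dk).
by move/is_derive_eq; apply; rewrite add0r mulr1.
Qed.

Lemma is_derive_kernel_x (y x : 'rV[R]_3) (s : R) j : 0 <= s ->
  is_derive x (delta_mx 0 j) (kernel y ^~ s) (kernel_x y j x s).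
Proof.
move=> s0; have v0 := variance_gt0 s s0.
apply/is_derive_line0; have := is_derive_norm2_sqr y x j.
move/is_derive_line0 => dn; rewrite /kernel.
have := is_derive_comp expR _ _ _ _ (is_derive_subf _ _ _ _ _ _
  (is_derive_cst (- (3 / 2) * ln (variance s)) (0:R) 1)
  (is_derive_mull (2 * variance s)^-1 _ _ _ _ dn)) (is_derive_expR _).
under [X in is_derive _ _ X _ -> _]eq_fun do rewrite [_^-1 * _]mulrC.
move/is_derive_eq; apply; rewrite /kernel_x /kernel scale0r addr0.
rewrite [_^-1 * norm2 _ ^+ 2]mulrC.
by move: (expR _) => e; field; rewrite gt_eqF.
Qed.

Lemma is_derive_kernel_xx (y x : 'rV[R]_3) (s : R) j : 0 <= s ->
  is_derive x (delta_mx 0 j) (kernel_x y j ^~ s) (kernel_xx y j x s).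
Proof.
move=> s0; have v0 := variance_gt0 s s0.
have -> : kernel_x y j ^~ s
    = (fun x => (- (variance s)^-1 * (x 0 j - y 0 j)) * kernel y x s).
  by apply/funext => z; rewrite /kernel_x !mxE; ring.
have := is_derive_mulf _ _ _ _ _ _ (is_derive_mull (- (variance s)^-1) _ _ _ _
  (is_derive_subf _ _ _ _ _ _ (is_derive_coord x j j)
    (is_derive_cst (y 0 j) x (delta_mx 0 j)))) (is_derive_kernel_x y x s j s0).
move/is_derive_eq; apply; rewrite /kernel_x /kernel_xx !mxE eqxx /cst /=.
by move: (kernel _ _ _) => e; field; rewrite gt_eqF.
Qed.

(** Coefficient of s^{-1/2} in the zeroth order error: the first term bounds 3(sigma' - 1)/(2 sigma)
    through sigma >= s, the second is B^2/(2(sigma' - 1)). *)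
Definition rate (B : R) : R :=
  9 / 4 * kappa / Num.sqrt T + B ^+ 2 * Num.sqrt T / (3 * kappa).

Lemma rate_ge0 B : 0 <= rate B.
Proof.
have t0 := ltW sqrtT_gt0; have k0 := ltW kappa_gt0.
apply: addr_ge0; apply: divr_ge0 => //; first exact: mulr_ge0.
- by apply: mulr_ge0; rewrite ?sqr_ge0.
- exact: mulr_ge0.
Qed.

Lemma kernel_supersolution (y x v : 'rV[R]_3) (B s : R) : norm2 v <= B -> 0 < s ->
  0 <= kernel_t y x s + \sum_j v 0 j * kernel_x y j x s
    - 2^-1 * \sum_j kernel_xx y j x s + rate B / Num.sqrt s * kernel y x s.
Proof.
move=> vB s0; have v0 := variance_gt0 s (ltW s0).
have r0 : 0 < Num.sqrt s by rewrite sqrtr_gt0.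
have t0 := sqrtT_gt0.
have B0 : 0 <= B := le_trans (norm2_ge0 v) vB.
have dotle : \sum_j v 0 j * (x - y) 0 j <= B * norm2 (x - y).
  by apply: le_trans (dot_le_norm2 _ _) _; rewrite ler_wpM2r ?norm2_ge0.
have vs : Num.sqrt s ^+ 2 <= variance s.
  rewrite (sqr_sqrtr (ltW s0)); apply: le_trans _ (variance_ge s (ltW s0)).
  by rewrite lerDr ltW.
(* For sigma' = 1 the kernel solves the heat equation, so after factoring it out only sigma' - 1,
   the drift and the rate remain. *)
have -> : kernel_t y x s + \sum_j v 0 j * kernel_x y j x s
    - 2^-1 * \sum_j kernel_xx y j x s + rate B / Num.sqrt s * kernel y x s
  = kernel y x s * ((dvariance s - 1) * (norm2 (x - y) ^+ 2 / (2 * variance s ^+ 2)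
      - 3 / (2 * variance s)) - (\sum_j v 0 j * (x - y) 0 j) / variance s
      + rate B / Num.sqrt s).
  rewrite /kernel_t /kernel_x /kernel_xx norm2_sqr !sum3E.
  move: (kernel y x s) ((x - y) 0) (dvariance s) (rate B) => k z d L.
  move: (variance s) v0 (Num.sqrt s) r0 {vs} => u u0 r r0.
  by field; rewrite !gt_eqF.
apply: mulr_ge0; first exact/ltW/kernel_gt0.
have n0 := norm2_ge0 (x - y).
rewrite /dvariance /rate; move: (norm2 _) n0 dotle => n n0 dotle.
move: (\sum_j _) dotle => D dotle.
move: (variance s) (Num.sqrt s) (Num.sqrt T) v0 r0 t0 vs => u r t u0 r0 t0 vs.
set d := 3 / 2 * kappa * r / t.
have d0 : 0 < d by rewrite divr_gt0 ?mulr_gt0.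
(* AM-GM absorbs the drift: B n / u <= d n^2 / (2 u^2) + B^2 / (2 d) *)
have amgm : D / u <= d * (n ^+ 2 / (2 * u ^+ 2)) + B ^+ 2 / (2 * d).
  have : D / u <= B * n / u by rewrite ler_pM2r ?invr_gt0.
  move/le_trans; apply; rewrite -subr_ge0.
  have -> : d * (n ^+ 2 / (2 * u ^+ 2)) + B ^+ 2 / (2 * d) - B * n / u
     = (d * n / u - B) ^+ 2 / (2 * d) by field; rewrite !gt_eqF.
  by rewrite divr_ge0 ?sqr_ge0// mulr_ge0// ltW.
have dE : B ^+ 2 / (2 * d) = B ^+ 2 * t / (3 * kappa) / r.
  by rewrite /d; field; rewrite !gt_eqF.
have spread : d * (3 / (2 * u)) <= 9 / 4 * kappa / t / r.
  have -> : 9 / 4 * kappa / t / r = d * (3 / (2 * r ^+ 2)).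
    by rewrite /d; field; rewrite !gt_eqF.
  rewrite ler_pM2l// ler_pM2l// lef_pV2 ?posrE ?mulr_gt0 ?exprn_gt0//.
  by rewrite ler_pM2l.
have -> : 1 + d - 1 = d by ring.
rewrite [(_ + _) / r]mulrDl mulrBr.
rewrite dE in amgm.
move: (d * (n ^+ 2 / _)) amgm => x3 amgm.
move: (B ^+ 2 * t / (3 * kappa) / r) amgm => x1 amgm.
move: (9 / 4 * kappa / t / r) spread => x2 spread.
lra.
Qed.

End Barrier.

(** * Compactness and periodicity *)

Section Periodic.
Context {R : realType}.

Lemma unit_periodic_int {T : Type} (f : 'rV[R]_3 -> T) (i : 'I_3) (m : int) x :
  unit_periodic f -> f (x + m%:~R *: delta_mx 0 i) = f x.
Proof.
move=> fper; have fnat (n : nat) y : f (y + n%:R *: delta_mx 0 i) = f y.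
  elim: n y => [|n IH] y; first by rewrite scale0r addr0.
  by rewrite -natr1 scalerDl scale1r addrA fper.
case: m => n; first exact: fnat.
by rewrite NegzE mulrNz scaleNr -[LHS](fnat n.+1) subrK.
Qed.

Lemma unit_cell_reduction (x : 'rV[R]_3) : exists2 y : 'rV[R]_3,
  forall i, `|y 0 i| <= 1 &
  forall (T : Type) (f : 'rV[R]_3 -> T), unit_periodic f -> f x = f y.
Proof.
pose m (i : 'I_3) := - Num.floor (x 0 i).
exists (x + (m 0)%:~R *: delta_mx 0 0 + (m 1)%:~R *: delta_mx 0 1
          + (m 2%:R)%:~R *: delta_mx 0 2%:R).
  move=> i.
  have -> : (x + (m 0)%:~R *: delta_mx 0 0 + (m 1)%:~R *: delta_mx 0 1
          + (m 2%:R)%:~R *: delta_mx 0 2%:R) 0 i = x 0 i - (Num.floor (x 0 i))%:~R.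
    rewrite !mxE /= -mulrNz -/(m i).
    have : (i == 0) || (i == 1) || (i == 2%:R) by case: i => [[|[|[|]]]].
    by case/orP => [/orP[]|] /eqP -> /=; rewrite ?mulr0 ?mulr1 ?addr0.
  have := floor_le (x 0 i); have := floorD1_gt (x 0 i).
  by rewrite intrD /= ler_norml => ? ?; apply/andP; split; lra.
by move=> T f fper; rewrite !unit_periodic_int.
Qed.

End Periodic.

Section Compactness.
Context {R : realType}.

(** The function [h] is the l^1 distance of x and y plus twice the positive part of eps - |f x - f
    y|. It is continuous and positive on a compact set, hence has a positive minimum; where |f x - f
    y| >= eps only the distance is left. *)
Lemma compact_heine (f : 'rV[R]_3 -> R) (r eps : R) : continuous f -> 0 < eps ->
  exists2 d : R, 0 < d & forall x y : 'rV[R]_3,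
    (forall i, `|x 0 i| <= r) -> (forall i, `|y 0 i| <= r) ->
    (forall i, `|x 0 i - y 0 i| <= d) -> `|f x - f y| < eps.
Proof.
move=> fc eps0.
pose h (p : 'rV[R]_3 * 'rV[R]_3) := (eps - `|f p.1 - f p.2|) +
  `|eps - `|f p.1 - f p.2| | + (`|p.1 0 0 - p.2 0 0| + `|p.1 0 1 - p.2 0 1|
    + `|p.1 0 2%:R - p.2 0 2%:R|).
have hc : continuous h.
  have c1 i : continuous (fun q : 'rV[R]_3 * 'rV[R]_3 => q.1 0 i).
    move=> p; apply: (@continuous_comp _ _ _ fst (fun x : 'rV[R]_3 => x 0 i));
      [exact: cvg_fst|exact: coord_continuous].
  have c2 i : continuous (fun q : 'rV[R]_3 * 'rV[R]_3 => q.2 0 i).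
    move=> p; apply: (@continuous_comp _ _ _ snd (fun x : 'rV[R]_3 => x 0 i));
      [exact: cvg_snd|exact: coord_continuous].
  have ce : continuous (fun q : 'rV[R]_3 * 'rV[R]_3 => eps - `|f q.1 - f q.2|).
    move=> p; apply: cvgB; first exact: cvg_cst.
    apply: cvg_norm; apply: cvgB.
      by apply: (@continuous_comp _ _ _ fst f); [exact: cvg_fst|exact: fc].
    by apply: (@continuous_comp _ _ _ snd f); [exact: cvg_snd|exact: fc].
  move=> p; apply: cvgD; first by apply: cvgD; [|apply: cvg_norm]; exact: ce.
  by do 2?apply: cvgD; apply: cvg_norm; (apply: cvgB; [exact: c1|exact: c2]).
pose K := [set x : 'rV[R]_3 | forall i, `[- r, r]%classic (x ord0 i)].
have inK (x : 'rV[R]_3) : (forall i, `|x 0 i| <= r) -> K x.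
  by move=> xr i /=; rewrite in_itv /= -ler_norml; exact: xr.
have Kc : compact (K `*` K).
  by apply: compact_setX; apply: (@rV_compact _ 3 (fun=> `[- r, r]%classic)) => i;
    exact: segment_compact.
have [r0|r0] := ltP r 0.
  exists 1 => // x y /(_ 0) xr; by have := le_lt_trans xr r0; rewrite ltNge normr_ge0.
have K0 : (K `*` K) !=set0.
  by exists (0, 0); split; apply: inK => i; rewrite mxE normr0.
have [[x0 y0] _ hmin] := compact_EVT_min K0 Kc (continuous_subspaceT hc).
have h0 : 0 < h (x0, y0).
  rewrite /h /=; have := normr_ge0 (x0 0 0 - y0 0 0).
  have := normr_ge0 (x0 0 1 - y0 0 1); have := normr_ge0 (x0 0 2%:R - y0 0 2%:R).
  have := ler_norm (- (eps - `|f x0 - f y0|)); rewrite normrN.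
  have [->|/eqP xy] := eqVneq x0 y0.
    by rewrite !subrr normr0 subr0 gtr0_norm//; lra.
  move=> n0 n1 n2 n3; rewrite lt_neqAle; apply/andP; split; last lra.
  apply/eqP => s0; apply: xy; apply/rowP => i.
  have : (i == 0) || (i == 1) || (i == 2%:R) by case: i => [[|[|[|]]]].
  by case/orP => [/orP[]|] /eqP ->; apply/eqP; rewrite -subr_eq0 -normr_le0; lra.
(* Three coordinate distances of at most a quarter of the minimum add up to less than the
   minimum. *)
exists (h (x0, y0) / 4); first by rewrite divr_gt0.
move=> x y xr yr xy; rewrite ltNge; apply/negP => fxy.
have := hmin (x, y); rewrite inE => /(_ (conj (inK _ xr) (inK _ yr))).
apply/negP; rewrite -ltNge {1}/h /=.
rewrite [`|eps - _|]ler0_norm ?subr_le0// subrr add0r.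
have := xy 0; have := xy 1; have := xy 2%:R; lra.
Qed.

Lemma continuous_norm2_within (A : set ('rV[R]_3 * R)) (w : 'rV[R]_3 -> R -> 'rV[R]_3) :
  (forall i, {within A, continuous (fun p => w p.1 p.2 0 i)}) ->
  {within A, continuous (fun p : 'rV[R]_3 * R => norm2 (w p.1 p.2))}.
Proof.
move=> wc.
have -> : (fun p : 'rV[R]_3 * R => norm2 (w p.1 p.2)) = Num.sqrt \o
    (fun p => w p.1 p.2 0 0 ^+ 2 + w p.1 p.2 0 1 ^+ 2 + w p.1 p.2 0 2%:R ^+ 2).
  by apply/funext => p; rewrite /norm2 sum3E.
move=> p; apply: (@continuous_comp _ _ _ (fun p : subspace A =>
  w p.1 p.2 0 0 ^+ 2 + w p.1 p.2 0 1 ^+ 2 + w p.1 p.2 0 2%:R ^+ 2) Num.sqrt);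
  last exact: sqrt_continuous.
by do 2?apply: cvgD; (apply: cvgM; exact: wc).
Qed.

Lemma box_nonempty (T : R) : 0 <= T ->
  [set p : 'rV[R]_3 * R | (forall i, `|p.1 0 i| <= 1) /\ 0 <= p.2 <= T] !=set0.
Proof.
by move=> T0; exists (0, 0); split=> [i|] /=; rewrite ?mxE ?normr0 ?ler01 ?lexx.
Qed.

(** Periodicity moves every point into a compact box. Attainment, rather than mere boundedness,
    places the bound below the supremum norm of the field. *)
Lemma periodic_bound_attained (F : 'rV[R]_3 -> R -> R) (T : R) : 0 <= T ->
  {within [set p : 'rV[R]_3 * R | 0 <= p.2], continuous (fun p => F p.1 p.2)} ->
  (forall s, 0 <= s -> unit_periodic (F^~ s)) ->
  exists (x : 'rV[R]_3) (s : R), 0 <= s <= T /\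
    forall y z, 0 <= z <= T -> F y z <= F x s.
Proof.
move=> T0 Fc Fper.
have Kc : {within [set p : 'rV[R]_3 * R | (forall i, `|p.1 0 i| <= 1) /\ 0 <= p.2 <= T],
    continuous (fun p => F p.1 p.2)}.
  by apply: continuous_subspaceW Fc => -[x s] /= [_ /andP[]].
have [[x s]] := compact_EVT_max (box_nonempty T T0) (compact_box 1 T) Kc.
rewrite inE /= => -[_ sT] Fmax; exists x, s; split=> // y z zT.
have [y' y'1 y'E] := unit_cell_reduction y.
have z0 : 0 <= z by move/andP: zT => [].
have -> : F y z = F y' z by exact: (y'E _ (F^~ z) (Fper z z0)).
by apply: (Fmax (y', z)); rewrite inE.
Qed.

End Compactness.

(** The two difference quotients are the same function, whether or not they converge. This serves
    both for translations by a period and for time slices of a smooth extension. *)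
Lemma derive_eq_lines {R : realType} {V W : normedModType R} (f : V -> R) (g : W -> R)
    (x v : V) (y u : W) :
  (forall h : R, f (h *: v + x) = g (h *: u + y)) -> 'D_v f x = 'D_u g y.
Proof.
move=> fg; rewrite /derive.
suff -> : (fun h : R => h^-1 *: ((f \o shift x) (h *: v) - f x))
  = (fun h : R => h^-1 *: ((g \o shift y) (h *: u) - g y)) by [].
apply/funext => h /=; rewrite fg.
by have := fg 0; rewrite !scale0r !add0r => ->.
Qed.

(** * Finite bounds for the drift and its gradient on [0, T] *)

Section DriftBounds.
Context {R : realType}.
Variables (b : 'rV[R]_3 -> R -> 'rV[R]_3).
Hypotheses (bsmooth : smooth_time_field b)
  (bper : forall t, 0 <= t -> unit_periodic (b^~ t)).

Lemma within_smooth_time (g : 'rV[R]_3 -> R -> R) (G : 'rV[R]_3 * R -> R) :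
  continuous G -> (forall x t, 0 <= t -> g x t = G (x, t)) ->
  {within [set p : 'rV[R]_3 * R | 0 <= p.2], continuous (fun p => g p.1 p.2)}.
Proof.
move=> Gc gG.
have : {within [set p : 'rV[R]_3 * R | 0 <= p.2], continuous G}.
  exact: continuous_subspaceT.
apply: subspace_eq_continuous => -[x t]; rewrite inE /= => t0.
by rewrite /from_subspace /= gG.
Qed.

(** A maximum over [0, T] is a real number even when [sup_norm b] is infinite. *)
Lemma drift_bound (T : R) : 0 <= T -> exists B : R,
  (forall x s, 0 <= s <= T -> norm2 (b x s) <= B) /\ (B%:E <= sup_norm b)%E.
Proof.
move=> T0; have [||x [s [sT bmax]]] := @periodic_bound_attained R (fun x s => norm2 (b x s)) T T0.
- apply: continuous_norm2_within => i; have [G Gs bG] := bsmooth i.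
  by apply: within_smooth_time bG; have [] := Gs 0.
- by move=> s s0 i x; rewrite bper.
exists (norm2 (b x s)); split=> //.
by apply: ereal_sup_ubound; exists (x, s) => //=; move/andP: sT => [].
Qed.

Lemma partial_smooth_time (g : 'rV[R]_3 -> R -> R) (G : 'rV[R]_3 * R -> R) j x t :
  (forall x t, 0 <= t -> g x t = G (x, t)) -> 0 <= t ->
  partial j (g^~ t) x = 'D_(delta_mx 0 j, 0) G (x, t).
Proof.
move=> gG t0; apply: derive_eq_lines => h.
rewrite gG//; congr G; congr (_, _) => /=.
by rewrite [h *: _]mulr0 add0r.
Qed.

Lemma partial_unit_periodic (f : 'rV[R]_3 -> R) j :
  unit_periodic f -> unit_periodic (partial j f).
Proof.
move=> fper i x; apply: derive_eq_lines => h.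
by rewrite addrA fper.
Qed.

(** The sum of the absolute values of the entries is continuous, hence bounded, and dominates
    [opnorm]. The weighted norm is therefore finite and can itself serve as K. *)
Lemma gradient_bound (T : R) : 0 <= T -> exists K : R,
  (forall x s, 0 <= s <= T ->
    Num.sqrt s * opnorm (gradient_matrix (b^~ s) x) <= K) /\
  (K%:E <= weighted_grad_norm b T)%E.
Proof.
move=> T0.
have [||x [s [sT gmax]]] := @periodic_bound_attained R (fun x s =>
  \sum_i \sum_j `|partial j (fun y => b y s 0 i) x|) T T0.
- have gc i j : {within [set p : 'rV[R]_3 * R | 0 <= p.2],
      continuous (fun p => `|partial j (fun y => b y p.2 0 i) p.1|)}.
    have [G Gs bG] := bsmooth i.
    have [_ /(_ (delta_mx 0 j, 0))[_ [Gc _]]] := Gs 1.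
    move=> p; apply: cvg_norm; move: p.
    apply: (within_smooth_time (fun x s => partial j (fun y => b y s 0 i) x) _ Gc).
    by move=> x s s0; exact: (partial_smooth_time (fun y s => b y s 0 i)).
  pose F i (p : 'rV[R]_3 * R) := `|partial 0 (fun y => b y p.2 0 i) p.1|
    + `|partial 1 (fun y => b y p.2 0 i) p.1| + `|partial 2%:R (fun y => b y p.2 0 i) p.1|.
  have Fc i : {within [set p : 'rV[R]_3 * R | 0 <= p.2], continuous (F i)}.
    by move=> p; apply: cvgD; [apply: cvgD|]; exact: gc.
  have -> : (fun p : 'rV[R]_3 * R =>
      \sum_i \sum_j `|partial j (fun y => b y p.2 0 i) p.1|)
      = (fun p => F 0 p + F 1 p + F 2%:R p).
    by apply/funext => p; rewrite !sum3E.
  by move=> p; apply: cvgD; [apply: cvgD|]; exact: Fc.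
- move=> s s0 i x; apply: eq_bigr => k _; apply: eq_bigr => j _; congr `|_|.
  apply: partial_unit_periodic => l y.
  by rewrite bper.
set M := \sum_i _ in gmax.
have gle y z : 0 <= z <= T ->
    Num.sqrt z * opnorm (gradient_matrix (b^~ z) y) <= Num.sqrt T * M.
  move=> zT; apply: ler_pM; rewrite ?sqrtr_ge0 ?opnorm_ge0//.
    by rewrite ler_wsqrtr//; move/andP: zT => [].
  apply: le_trans (opnorm_le_sum _) _; apply: le_trans (gmax y z zT).
  by apply: ler_sum => i _; apply: ler_sum => j _; rewrite mxE.
have wfin : weighted_grad_norm b T \is a fin_num.
  rewrite fin_numElt; apply/andP; split.
    apply: (@lt_le_trans _ _ 0%E) => //; apply: ereal_sup_ubound.
    by exists (0, 0) => /=; rewrite ?lexx// sqrtr0 mul0r.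
  apply: (@le_lt_trans _ _ (Num.sqrt T * M)%:E); last exact: ltry.
  by apply: ge_ereal_sup => _ [[y z] /= zT <-]; rewrite lee_fin gle.
exists (fine (weighted_grad_norm b T)); split; last by rewrite fineK.
move=> y z zT; rewrite -lee_fin fineK//.
by apply: ereal_sup_ubound; exists (y, z).
Qed.

End DriftBounds.

(** * Lower sums *)

Section LowerSums.
Context d (T : measurableType d) {R : realType} (mu : {measure set T -> \bar R}).
Import HBNNSimple.

(** By disjointness the simple function with value [c i] on [Q i] lies below F, and the integral of
    a nonnegative function is a supremum over such simple functions. *)
Lemma lower_sum_le_integral (I : finType) (Q : I -> set T) (c : I -> R) (F : T -> R) :
  (forall i, measurable (Q i)) -> (forall i j p, Q i p -> Q j p -> i = j) ->
  (forall i, 0 <= c i) -> (forall p, 0 <= F p) ->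
  (forall i p, Q i p -> c i <= F p) ->
  (\sum_i (c i)%:E * mu (Q i) <= \int[mu]_p (F p)%:E)%E.
Proof.
move=> mQ Qdisj c0 F0 cF.
pose g := \big[add_nnsfun/nnsfun0]_i scale_nnsfun (indic_nnsfun R (mQ i)) (c0 i).
have gE p : g p = \sum_i c i * \1_(Q i) p.
  by rewrite /g; elim/big_ind2 : _ => [|x u y v <- <-|].
have gint : sintegral mu g = (\sum_i (c i)%:E * mu (Q i))%E.
  rewrite /g; elim/big_ind2 : _ => [|x u y v <- <-|i _].
  - by rewrite sintegral0.
  - by rewrite sintegralD.
  - by rewrite sintegralrM sintegral_indic.
rewrite ge0_integralTE => [|p]; last by rewrite lee_fin.
apply: ereal_sup_ubound; exists g => // p; rewrite lee_fin gE.
have [[i Qi]|nQ] := pselect (exists i, Q i p).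
  rewrite (bigD1 i)//= big1 ?addr0 => [|j ji].
    by rewrite indicE mem_set// mulr1 cF.
  rewrite indicE memNset ?mulr0// => Qj.
  by move/negP: ji; apply; apply/eqP; exact: Qdisj Qj Qi.
rewrite big1 // => i _; rewrite indicE memNset ?mulr0// => Qi.
by apply: nQ; exists i.
Qed.

End LowerSums.

Lemma sigma_finite_lebesgue_plane (R : realType) :
  sigma_finite setT (@lebesgue_measure R \x @lebesgue_measure R)%E.
Proof.
pose I (n : nat) : set R := `[- n%:R, n%:R]%classic.
have mI n : measurable (I n) by exact: measurable_itv.
have Ioo n : (lebesgue_measure (I n) < +oo)%E.
  by rewrite lebesgue_measure_itv /=; case: ifP => _; rewrite ?ltry// -EFinD ltry.
exists (fun n => I n `*` I n); last first.
  move=> n; split; first by apply: measurableX; exact: mI.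
  have -> : (@lebesgue_measure R \x @lebesgue_measure R)%E (I n `*` I n)
      = (lebesgue_measure (I n) * lebesgue_measure (I n))%E.
    by apply: product_measure1E; exact: mI.
  by rewrite lte_mul_pinfty// ge0_fin_numE.
apply/seteqP; split => // -[x y] _.
exists (Num.truncn (Num.max `|x| `|y|)).+1 => //.
have : Num.max `|x| `|y| < (Num.truncn (Num.max `|x| `|y|)).+1%:R by exact: truncnS_gt.
rewrite gt_max => /andP[/ltW xn /ltW yn].
by split; rewrite /I /= in_itv /= -ler_norml.
Qed.

(* The sigma-finite structure of a product of measures is not inferred (the
   instance for subprobabilities shadows it), hence the explicit packing. *)
Definition lebesgue_plane {R : realType} :
    {sigma_finite_measure set (measurableTypeR R * measurableTypeR R)%type -> \bar R} :=
  HB.pack_for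
    {sigma_finite_measure set (measurableTypeR R * measurableTypeR R)%type -> \bar R}
    (@lebesgue_measure R \x @lebesgue_measure R)%E
    (@Measure_isSigmaFinite.Build _ _ _ (@lebesgue_measure R \x @lebesgue_measure R)%E
      (sigma_finite_lebesgue_plane R)).

(** * Lattice cubes of side h *)

Section Cells.
Context {R : realType}.
Variables (r h : R) (n : nat).
Hypothesis h_gt0 : 0 < h.

Definition corner (i : 'I_n * ('I_n * 'I_n)) : R * (R * R) :=
  (h * i.1%:R - r, (h * i.2.1%:R - r, h * i.2.2%:R - r)).

(** Half-open edges make distinct cubes disjoint while they still cover the box. *)
Definition cell (i : 'I_n * ('I_n * 'I_n)) : set (R * (R * R)) :=
  `[(corner i).1, (corner i).1 + h[%classic `*`
  (`[(corner i).2.1, (corner i).2.1 + h[%classic `*`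
   `[(corner i).2.2, (corner i).2.2 + h[%classic).

Lemma measurable_cell i : measurable (cell i).
Proof. by do 2?apply: measurableX; exact: measurable_itv. Qed.

Lemma cell_inj i j p : cell i p -> cell j p -> i = j.
Proof.
have sep (k l : 'I_n) (x : R) : x \in `[h * k%:R - r, h * k%:R - r + h[ ->
    x \in `[h * l%:R - r, h * l%:R - r + h[ -> (k <= l)%N.
  rewrite !in_itv /= => /andP[kx _] /andP[_ xl].
  have : h * k%:R < h * (l%:R + 1) by rewrite mulrDr mulr1; lra.
  by rewrite ltr_pM2l// natr1 ltr_nat ltnS.
case: i j p => [i1 [i2 i3]] [j1 [j2 j3]] [p1 [p2 p3]] [/= a1 [/= a2 a3]] [/= b1 [/= b2 b3]].
have eqI (k l : 'I_n) : (k <= l)%N -> (l <= k)%N -> k = l.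
  by move=> kl lk; apply/val_inj/eqP; rewrite eqn_leq kl.
congr (_, (_, _)); apply: eqI.
- exact: sep a1 b1.
- exact: sep b1 a1.
- exact: sep a2 b2.
- exact: sep b2 a2.
- exact: sep a3 b3.
- exact: sep b3 a3.
Qed.

Lemma volume_cell i : ((lebesgue_measure \x lebesgue_plane) (cell i) = (h ^+ 3)%:E)%E.
Proof.
have len (a : R) : lebesgue_measure `[a, a + h[%classic = h%:E.
  by rewrite lebesgue_measure_itv /= lte_fin ltrDl h_gt0 -EFinD addrAC subrr add0r.
have mI (a b : R) : measurable (`[a, b[%classic : set R) by exact: measurable_itv.
have E2 a b : lebesgue_plane (`[a, a + h[%classic `*` `[b, b + h[%classic) = (h ^+ 2)%:E.
  transitivity (lebesgue_measure `[a, (a + h)%R[%classic *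
    lebesgue_measure `[b, (b + h)%R[%classic)%E.
    by apply: product_measure1E; exact: mI.
  by rewrite !len -EFinM.
transitivity (lebesgue_measure `[(corner i).1, ((corner i).1 + h)%R[%classic *
    lebesgue_plane (`[(corner i).2.1, ((corner i).2.1 + h)%R[%classic `*`
      `[(corner i).2.2, ((corner i).2.2 + h)%R[%classic))%E.
  by apply: product_measure1E; [exact: mI|apply: measurableX; exact: mI].
by rewrite E2 len -EFinM exprS.
Qed.

Lemma cell_dist i p (k : 'I_3) : cell i p -> `|vec3 p 0 k - vec3 (corner i) 0 k| <= h.
Proof.
have dist (a x : R) : x \in `[a, a + h[ -> `|x - a| <= h.
  by rewrite in_itv /= => /andP[? ?]; rewrite ger0_norm; lra.
case: i p => [i1 [i2 i3]] [p1 [p2 p3]] [/= a1 [/= a2 a3]]; rewrite !mxE.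
by case: k => [[|[|[|//]]] km]; rewrite !(tnth_nth 0) /=; exact: dist.
Qed.

(** The index in direction k is the integer part of (x_k + r)/h; the strict inequality keeps it
    below n even for x_k = r. *)
Lemma cell_cover (x : 'rV[R]_3) : 2 * r < h * n%:R ->
  (forall k, `|x 0 k| <= r) -> exists2 p, x = vec3 p & exists i, cell i p.
Proof.
move=> rn xr.
have idx k : {i : 'I_n | x 0 k \in `[h * i%:R - r, h * i%:R - r + h[}.
  have [x1 x2] : - r <= x 0 k /\ x 0 k <= r by apply/andP; rewrite -ler_norml.
  have q0 : 0 <= (x 0 k + r) / h by rewrite divr_ge0 ?(ltW h_gt0)//; lra.
  have lt : (Num.truncn ((x 0 k + r) / h)%R < n)%N.
    by rewrite truncn_lt_nat// ltr_pdivrMr// mulrC; lra.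
  exists (Ordinal lt); rewrite in_itv /=.
  have := truncn_itv q0; rewrite ler_pdivlMr// ltr_pdivrMr// -natr1.
  move: (Num.truncn _)%:R => a /andP[ax xa].
  by apply/andP; split; lra.
exists (x 0 0, (x 0 1, x 0 2%:R)).
  apply/rowP => k; rewrite mxE (tnth_nth 0) /=.
  by case: k => [[|[|[|//]]] km] /=; congr (x 0 _); apply: val_inj.
exists (sval (idx 0), (sval (idx 1), sval (idx 2%:R))).
by split; [exact: (svalP (idx 0))|split; [exact: (svalP (idx 1))|exact: (svalP (idx 2%:R))]].
Qed.

End Cells.

(** * Comparison of Gaussians *)

Section KernelEstimates.
Context {R : realType}.

Lemma norm2_le_box (z : 'rV[R]_3) (h : R) : (forall i, `|z 0 i| <= h) ->
  norm2 z ^+ 2 <= 3 * h ^+ 2.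
Proof.
move=> zh; rewrite norm2_sqr sum3E -!(real_normK (num_real (z 0 _))).
have zh2 i : `|z 0 i| ^+ 2 <= h ^+ 2.
  by rewrite ler_pXn2r ?nnegrE// (le_trans _ (zh i)).
by have := zh2 0; have := zh2 1; have := zh2 2%:R; lra.
Qed.

(** Weighted Young inequality, coordinate by coordinate; the defect is (k a - b)^2 / k. *)
Lemma norm2D_sqr_le (u v : 'rV[R]_3) (k : R) : 0 < k ->
  norm2 (u + v) ^+ 2 <= (1 + k) * norm2 u ^+ 2 + (1 + k^-1) * norm2 v ^+ 2.
Proof.
move=> k0; rewrite !norm2_sqr !mulr_sumr -big_split /=; apply: ler_sum => i _.
rewrite mxE; move: (u 0 i) (v 0 i) => a b.
rewrite -subr_ge0.
have -> : (1 + k) * a ^+ 2 + (1 + k^-1) * b ^+ 2 - (a + b) ^+ 2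
   = (k * a - b) ^+ 2 / k by field; rewrite gt_eqF.
by rewrite divr_ge0 ?sqr_ge0// ltW.
Qed.

Variables (kappa T h : R).
Hypotheses (kappa_gt0 : 0 < kappa) (T_gt0 : 0 < T) (h_gt0 : 0 < h).

(** The initial variance is the squared mesh and |x - y|^2 <= 3 h^2, so the prefactor is h^{-3} and
    the exponent loses at most 3/2. *)
Lemma kernel_start (y x : 'rV[R]_3) : (forall i, `|(x - y) 0 i| <= h) ->
  1 <= expR (3 / 2) * h ^+ 3 * kernel (h ^+ 2) kappa T y x 0.
Proof.
move=> xy; have d2 := norm2_le_box _ _ xy.
rewrite -{1}(lnK h_gt0) -expRM_natl -!expRD -[leLHS]expR0 ler_expR variance0.
rewrite lnXn//.
have : norm2 (x - y) ^+ 2 / (2 * h ^+ 2) <= 3 / 2.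
  rewrite ler_pdivrMr ?mulr_gt0 ?exprn_gt0//; lra.
by move: (norm2 _ ^+ 2 / _) (ln h) => a b; lra.
Qed.

(** Moving the centre from y to z costs a factor 1 + kappa by Young's inequality, and the final
    variance lies between T and (1 + 2 kappa) T; beta pays for both factors. The remainder (1 +
    1/kappa)|z - y|^2 gives the 3/2 in the constant, the missing normalization gives the
    logarithm. *)
Lemma kernel_end (beta : R) (z y x : 'rV[R]_3) :
  (1 + kappa) * (1 + 2 * kappa) <= beta -> h ^+ 2 <= kappa * T ->
  (forall i, `|(z - y) 0 i| <= h) ->
  kernel (h ^+ 2) kappa T y x T
    <= expR (3 / 2 + 3 / 2 * ln (2 * pi * beta)) * gauss (beta * T) (x - z).
Proof.
move=> kb hT zy; have d2 := norm2_le_box _ _ zy.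
have h2 : 0 < h ^+ 2 by rewrite exprn_gt0.
have k0 : 0 < kappa := kappa_gt0.
have t0 : 0 < T := T_gt0.
have b0 : 0 < beta by apply: lt_le_trans kb; apply: mulr_gt0; lra.
have pb0 : 0 < 2 * pi * beta by rewrite mulr_gt0 ?mulr_gt0 ?pi_gt0.
have vT : variance (h ^+ 2) kappa T T <= (1 + 2 * kappa) * T.
  by rewrite variance_end//; lra.
have Tv : T <= variance (h ^+ 2) kappa T T.
  by rewrite variance_end// mulrDl; have := mulr_gt0 kappa_gt0 T_gt0; lra.
have v0 : 0 < variance (h ^+ 2) kappa T T by exact: lt_le_trans Tv.
rewrite /kernel /gauss /powR [2 * pi * (beta * T)]mulrA gt_eqF ?mulr_gt0 ?pi_gt0// -!expRD ler_expR.
rewrite [ln (_ * T)]lnM ?posrE//.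
have lnle : ln T <= ln (variance (h ^+ 2) kappa T T) by rewrite ler_ln ?posrE.
have tri := norm2D_sqr_le (x - y) (y - z) _ kappa_gt0.
rewrite addrA subrK in tri.
have yz : norm2 (y - z) ^+ 2 = norm2 (z - y) ^+ 2.
  by rewrite -opprB -scaleN1r norm2Z normrN1 mul1r.
rewrite yz in tri.
have n0 : 0 <= norm2 (x - y) ^+ 2 := sqr_ge0 _.
have quad : norm2 (x - z) ^+ 2 / (2 * (beta * T))
    <= norm2 (x - y) ^+ 2 / (2 * variance (h ^+ 2) kappa T T) + 3 / 2.
  move: (norm2 (x - z) ^+ 2) (norm2 (x - y) ^+ 2) (norm2 (z - y) ^+ 2) tri d2 n0 => A B C tri d2 n0.
  move: (variance _ _ _ _) vT Tv v0 => v vT Tv v0.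
  have bT : 0 < 2 * (beta * T) by rewrite !mulr_gt0.
  rewrite ler_pdivrMr// mulrDl.
  have E1 : (1 + kappa) * B <= B / (2 * v) * (2 * (beta * T)).
    have -> : B / (2 * v) * (2 * (beta * T)) = B * (beta * T / v) by field; rewrite gt_eqF.
    rewrite mulrC ler_wpM2l// ler_pdivlMr//.
    apply: le_trans (_ : (1 + kappa) * ((1 + 2 * kappa) * T) <= _).
      by rewrite ler_pM2l//; lra.
    by rewrite mulrA ler_pM2r.
  have E2 : (1 + kappa^-1) * C <= 3 / 2 * (2 * (beta * T)).
    apply: le_trans (_ : (1 + kappa^-1) * (3 * (kappa * T)) <= _).
      by rewrite ler_pM2l ?addr_gt0 ?invr_gt0//; lra.
    have -> : (1 + kappa^-1) * (3 * (kappa * T)) = 3 * ((1 + kappa) * T).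
      by field; rewrite gt_eqF.
    have -> : 3 / 2 * (2 * (beta * T)) = 3 * (beta * T) by field.
    rewrite ler_pM2l// ler_pM2r//; apply: le_trans kb.
    by rewrite ler_peMr//; lra.
  lra.
move: quad; rewrite [- norm2 _ ^+ 2 / _]mulNr.
move: (norm2 (x - z) ^+ 2 / _) => a; move: (norm2 _ ^+ 2 / _) => c quad; lra.
Qed.

Lemma continuous_kernel (y : 'rV[R]_3) (p : 'rV[R]_3 * R) : 0 <= p.2 ->
  {for p, continuous (fun p => kernel (h ^+ 2) kappa T y p.1 p.2)}.
Proof.
move=> p0; have v0 : 0 < variance (h ^+ 2) kappa T p.2.
  by apply: variance_gt0 => //; rewrite exprn_gt0.
have cv : {for p, continuous (fun p : 'rV[R]_3 * R => variance (h ^+ 2) kappa T p.2)}.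
  by apply: (@continuous_comp _ _ _ snd (variance (h ^+ 2) kappa T));
    [exact: cvg_snd|exact: continuous_variance].
have cx (i : 'I_3) : {for p, continuous (fun p : 'rV[R]_3 * R => (p.1 - y) 0 i)}.
  have -> : (fun p : 'rV[R]_3 * R => (p.1 - y) 0 i) = (fun p => p.1 0 i - y 0 i).
    by apply/funext => q; rewrite !mxE.
  apply: cvgB; last exact: cvg_cst.
  by apply: (@continuous_comp _ _ _ fst (fun x : 'rV[R]_3 => x 0 i));
    [exact: cvg_fst|exact: coord_continuous].
have -> : (fun p => kernel (h ^+ 2) kappa T y p.1 p.2) = (fun p : 'rV[R]_3 * R =>
   expR (- (3 / 2) * ln (variance (h ^+ 2) kappa T p.2)
     - ((p.1 - y) 0 0 * (p.1 - y) 0 0 + (p.1 - y) 0 1 * (p.1 - y) 0 1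
        + (p.1 - y) 0 2%:R * (p.1 - y) 0 2%:R) / (2 * variance (h ^+ 2) kappa T p.2))).
  by apply/funext => q; rewrite /kernel norm2_sqr sum3E !expr2.
apply: (@continuous_comp _ _ _ (fun p : 'rV[R]_3 * R => _) expR); last exact: continuous_expR.
apply: cvgB.
  apply: cvgM; first exact: cvg_cst.
  by apply: (@continuous_comp _ _ _ (fun p : 'rV[R]_3 * R => variance (h ^+ 2) kappa T p.2)
    (@ln R)); [exact: cv|exact: continuous_ln].
apply: cvgM.
  by do 2?apply: cvgD; (apply: cvgM; exact: cx).
apply: cvgV; first by rewrite mulf_neq0// gt_eqF.
by apply: cvgM; [exact: cvg_cst|exact: cv].
Qed.

End KernelEstimates.

(** * Superposition *)

Section Superposition.
Context {R : realType}.

(** By this linearity, combinations of kernels with nonnegative coefficients remain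
    supersolutions. *)
Lemma contract_sum (I : finType) (c kt k : I -> R) (kx kxx : I -> 'I_3 -> R)
    (v : 'I_3 -> R) (rho : R) :
  \sum_i c i * (kt i + \sum_j v j * kx i j - 2^-1 * \sum_j kxx i j + rho * k i)
  = \sum_i c i * kt i + \sum_j v j * (\sum_i c i * kx i j)
    - 2^-1 * \sum_j \sum_i c i * kxx i j + rho * \sum_i c i * k i.
Proof.
have -> : \sum_j v j * (\sum_i c i * kx i j) = \sum_i c i * \sum_j v j * kx i j.
  under eq_bigr do rewrite mulr_sumr.
  rewrite exchange_big /=; apply: eq_bigr => i _; rewrite mulr_sumr.
  by apply: eq_bigr => j _; rewrite mulrCA.
rewrite exchange_big /= !mulr_sumr -sumrN -!big_split /=.
by apply: eq_bigr => i _; rewrite -mulr_sumr; ring.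
Qed.

Lemma is_derive_norm2_sqr0 (x : 'rV[R]_3) j :
  is_derive x (delta_mx 0 j) (fun x => norm2 x ^+ 2) (2 * x 0 j).
Proof.
have := is_derive_norm2_sqr 0 x j; rewrite subr0.
by have -> : (fun x : 'rV[R]_3 => norm2 (x - 0) ^+ 2) = (fun x => norm2 x ^+ 2)
  by apply/funext => y; rewrite subr0.
Qed.

Lemma continuous_norm2_sqr_fst : continuous (fun p : 'rV[R]_3 * R => norm2 p.1 ^+ 2).
Proof.
have -> : (fun p : 'rV[R]_3 * R => norm2 p.1 ^+ 2) = (fun p =>
    p.1 0 0 * p.1 0 0 + p.1 0 1 * p.1 0 1 + p.1 0 2%:R * p.1 0 2%:R).
  by apply/funext => p; rewrite norm2_sqr sum3E !expr2.
have cx (i : 'I_3) : continuous (fun p : 'rV[R]_3 * R => p.1 0 i).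
  by move=> p; apply: (@continuous_comp _ _ _ fst (fun x : 'rV[R]_3 => x 0 i));
    [exact: cvg_fst|exact: coord_continuous].
by move=> p; do 2?apply: cvgD; (apply: cvgM; exact: cx).
Qed.

Lemma within_continuous_norm2_solution (b w : 'rV[R]_3 -> R -> 'rV[R]_3) w0 :
  periodic_solution b w0 w ->
  {within [set p : 'rV[R]_3 * R | 0 <= p.2], continuous (fun p => norm2 (w p.1 p.2))}.
Proof. by move=> [wreg _ _ _]; apply: continuous_norm2_within => i; have [] := wreg i. Qed.

(** The kernels dominate w at time 0, up to eps N; the quadratic eps |x|^2 dominates it on the
    lateral faces because |w| <= eps r^2. *)
Lemma superposition_bound (b w : 'rV[R]_3 -> R -> 'rV[R]_3)
    (w0 : 'rV[R]_3 -> 'rV[R]_3) (kappa T h B K eps r : R) (I : finType)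
    (c : I -> R) (y : I -> 'rV[R]_3) :
  let N := 4 * T + B ^+ 2 * T ^+ 2 in
  let g i := kernel (h ^+ 2) kappa T (y i) in
  0 < kappa -> 0 < T -> 0 < h -> 0 < eps -> 0 <= r ->
  periodic_solution b w0 w ->
  (forall (x : 'rV[R]_3) (s : R), 0 <= s <= T -> norm2 (b x s) <= B) ->
  (forall (x : 'rV[R]_3) (s : R), 0 <= s <= T ->
    Num.sqrt s * opnorm (gradient_matrix (b^~ s) x) <= K) ->
  (forall (x : 'rV[R]_3) (s : R), 0 <= s <= T -> norm2 (w x s) <= eps * r ^+ 2) ->
  (forall i, 0 <= c i) ->
  (forall x : 'rV[R]_3, (forall k, `|x 0 k| <= r) ->
    norm2 (w x 0) <= eps * N + \sum_i c i * g i x 0) ->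
  forall x : 'rV[R]_3, (forall k, `|x 0 k| <= r) ->
    norm2 (w x T) <= expR (2 * (K + rate kappa T B) * Num.sqrt T + 1) *
      (eps * (N + norm2 x ^+ 2) + \sum_i c i * g i x T).
Proof.
move=> N g k0 T0 h0 e0 r0 sol bB AK wM c0 init.
have h20 : 0 < h ^+ 2 by rewrite exprn_gt0.
set L := rate kappa T B.
have L0 : 0 <= L by exact: rate_ge0.
have K0 : 0 <= K.
  have := AK 0 0; rewrite lexx ltW// => /(_ isT).
  by apply: le_trans; rewrite sqrtr0 mul0r.
have B0 : 0 <= B by have := bB 0 0; rewrite lexx ltW// => /(_ isT); exact/le_trans/norm2_ge0.
have N0 : 0 <= N by rewrite /N; have := sqr_ge0 (B * T); rewrite exprMn; lra.
have g0 i (x : 'rV[R]_3) s : 0 <= c i * g i x s by rewrite mulr_ge0// ltW// kernel_gt0.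
(* In the derivative, K / sqrt s absorbs the stretching, L / sqrt s the error of the kernels, and
   1/T supplies the damping that makes the quadratic barrier strict. The last term contributes the +
   1 to the final exponent. *)
pose th s := 2 * (K + L) * Num.sqrt s + s / T.
pose U (x : 'rV[R]_3) s := eps * (N + norm2 x ^+ 2) + \sum_i c i * g i x s.
have Uge (x : 'rV[R]_3) s : eps * (N + norm2 x ^+ 2) <= U x s.
  by rewrite lerDl sumr_ge0.
have th0 s : 0 <= s -> 0 <= th s.
  move=> s0; rewrite /th addr_ge0// ?divr_ge0 ?(ltW T0)//.
  by rewrite mulr_ge0 ?sqrtr_ge0// mulr_ge0// addr_ge0.
suff main (x : 'rV[R]_3) s : (forall k, `|x 0 k| <= r) -> 0 <= s <= T ->
    expR (- th s) * norm2 (w x s) <= U x s.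
  move=> x xr; have := main x T xr; rewrite lexx ltW// => /(_ isT).
  rewrite expRN mulrC ler_pdivrMr ?expR_gt0// mulrC.
  by rewrite {1}/th divff ?gt_eqF.
move=> xr sT; refine (@weighted_maximum_principle R b w w0 r T (fun s => K / Num.sqrt s) th
  (fun s => (K + L) / Num.sqrt s + T^-1) U
  (fun x s => \sum_i c i * kernel_t (h ^+ 2) kappa T (y i) x s)
  (fun j x s => eps * (2 * x 0 j)
     + \sum_i c i * kernel_x (h ^+ 2) kappa T (y i) j x s)
  (fun j x s => eps * 2 + \sum_i c i * kernel_xx (h ^+ 2) kappa T (y i) j x s)
  sol _ _ _ _ _ _ _ _ _ _ x s xr sT); clear x s xr sT.
- have thc : continuous th.
    move=> s; apply: cvgD; apply: cvgM; [exact: cvg_cst|exact: sqrt_continuous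
      |exact: cvg_id|exact: cvg_cst].
  have Uc : {within [set p : 'rV[R]_3 * R | (forall i, `|p.1 0 i| <= r) /\ 0 <= p.2 <= T],
      continuous (fun p => U p.1 p.2)}.
    apply: continuous_in_subspaceT => -[x0 s0]; rewrite inE /= => -[_ /andP[s00 _]].
    rewrite /U; apply: cvgD.
      apply: cvgM; first exact: cvg_cst.
      apply: cvgD; first exact: cvg_cst.
      exact: continuous_norm2_sqr_fst.
    apply: cvg_big => [|i _]; first exact: add_continuous.
    apply: cvgM; first exact: cvg_cst.
    exact: (@continuous_kernel R kappa T h k0 h0 (y i) (x0, s0) s00).
  have wc : {within [set p : 'rV[R]_3 * R | (forall i, `|p.1 0 i| <= r) /\ 0 <= p.2 <= T],
      continuous (fun p => norm2 (w p.1 p.2))}.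
    apply: continuous_subspaceW (within_continuous_norm2_solution _ _ _ sol).
    by move=> -[x s] /= [_ /andP[]].
  have Ec : {within [set p : 'rV[R]_3 * R | (forall i, `|p.1 0 i| <= r) /\ 0 <= p.2 <= T],
      continuous (fun p => expR (- th p.2))}.
    apply: continuous_subspaceT => p.
    apply: (@continuous_comp _ _ _ (fun p : 'rV[R]_3 * R => - th p.2) expR);
      last exact: continuous_expR.
    apply: cvgN; apply: (@continuous_comp _ _ _ snd th); [exact: cvg_snd|exact: thc].
  by move=> p; apply: cvgB; [apply: cvgM; [exact: Ec|exact: wc]|exact: Uc].
- move=> z s zr /andP[s0 sT]; rewrite ler_pdivlMr ?sqrtr_gt0// mulrC.
  by apply: AK; rewrite (ltW s0).
- move=> s /andP[s0 _].
  have := is_derive_addf _ _ _ _ _ _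
    (is_derive_mull (2 * (K + L)) _ _ _ _ (is_derive1_sqrt s0))
    (is_derive_mull T^-1 _ _ _ _ (is_derive_id s 1)).
  have -> : (fun s => 2 * (K + L) * Num.sqrt s + T^-1 * s) = th.
    by apply/funext => z; rewrite /th [z / T]mulrC.
  move/is_derive_eq; apply; rewrite mulr1; congr (_ + _).
  by field; rewrite gt_eqF// sqrtr_gt0.
- move=> s /andP[s0 _]; rewrite mulrDl -addrA lerDl addr_ge0 ?divr_ge0 ?sqrtr_ge0//.
  by rewrite invr_ge0 ltW.
- move=> z s _; apply: le_trans (Uge z s).
  by rewrite mulr_ge0 ?(ltW e0)// addr_ge0// sqr_ge0.
- move=> z s /andP[s0 _].
  have := is_derive_addf _ _ _ _ _ _ (is_derive_cst (eps * (N + norm2 z ^+ 2)) s 1)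
    (is_derive_sumf _ (fun i s => c i * g i z s) s 1 _ (fun i =>
       is_derive_mull (c i) _ _ _ _
         (is_derive_kernel_t _ _ _ h20 k0 T0 (y i) z s s0))).
  by rewrite add0r.
- move=> j z s /andP[s0 _].
  have := is_derive_addf _ _ _ _ _ _ (is_derive_mull eps _ _ _ _
      (is_derive_addf _ _ _ _ _ _ (is_derive_cst N z (delta_mx 0 j))
        (is_derive_norm2_sqr0 z j)))
    (is_derive_sumf _ (fun i z => c i * g i z s) z (delta_mx 0 j) _ (fun i =>
       is_derive_mull (c i) _ _ _ _
         (is_derive_kernel_x _ _ _ h20 k0 (y i) z s j (ltW s0)))).
  by rewrite add0r.
- move=> j z s /andP[s0 _].
  have := is_derive_addf _ _ _ _ _ _ (is_derive_mull eps _ _ _ _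
      (is_derive_mull 2 _ _ _ _ (is_derive_coord z j j)))
    (is_derive_sumf _ (fun i z => c i * kernel_x (h ^+ 2) kappa T (y i) j z s)
       z (delta_mx 0 j) _ (fun i =>
       is_derive_mull (c i) _ _ _ _
         (is_derive_kernel_xx _ _ _ h20 k0 (y i) z s j (ltW s0)))).
  by rewrite eqxx mulr1.
- move=> z s zr /andP[s0 sT].
  have rs0 : 0 < Num.sqrt s by rewrite sqrtr_gt0.
  have vB : norm2 (b z s) <= B by apply: bB; rewrite (ltW s0).
  have dot : - \sum_j b z s 0 j * z 0 j <= B * norm2 z.
    rewrite -sumrN; apply: le_trans (_ : norm2 (- b z s) * norm2 z <= _).
      apply: le_trans (dot_le_norm2 _ _); apply: ler_sum => j _.
      by rewrite mxE mulNr.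
    by rewrite -scaleN1r norm2Z normrN1 mul1r ler_wpM2r ?norm2_ge0.
  have := contract_sum I c (fun i => kernel_t (h ^+ 2) kappa T (y i) z s)
    (fun i => kernel (h ^+ 2) kappa T (y i) z s)
    (fun i j => kernel_x (h ^+ 2) kappa T (y i) j z s)
    (fun i j => kernel_xx (h ^+ 2) kappa T (y i) j z s)
    (fun j => b z s 0 j) (L / Num.sqrt s).
  set S := (X in X = _ -> _) => SE.
  have S0 : 0 <= S.
    apply: sumr_ge0 => i _; apply: mulr_ge0 => //.
    exact: (kernel_supersolution _ _ _ h20 k0 T0 (y i) z (b z s) B s vB s0).
  have Sk0 : 0 <= \sum_i c i * g i z s by apply: sumr_ge0.
  rewrite SE in S0; rewrite /U.
  have -> : \sum_j b z s 0 j * (eps * (2 * z 0 j)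
       + \sum_i c i * kernel_x (h ^+ 2) kappa T (y i) j z s)
     = eps * 2 * (\sum_j b z s 0 j * z 0 j)
       + \sum_j b z s 0 j * (\sum_i c i * kernel_x (h ^+ 2) kappa T (y i) j z s).
    by rewrite !sum3E; ring.
  rewrite big_split /= sumr_const card_ord -mulr_natl.
  have -> : (K + L) / Num.sqrt s + T^-1 - K / Num.sqrt s = L / Num.sqrt s + T^-1.
    by rewrite mulrDl; ring.
  have rho0 : 0 <= L / Num.sqrt s by rewrite divr_ge0// ltW.
  have n0 := norm2_ge0 z.
  move: S0 Sk0 dot; rewrite /g.
  set Sk := \sum_i c i * kernel _ _ _ _ _ _; set St := \sum_i c i * kernel_t _ _ _ _ _ _.
  set D := \sum_j _ * z 0 j; set Sx := \sum_j b z s 0 j * (\sum_i _).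
  set Sxx := \sum_j \sum_i c i * kernel_xx _ _ _ _ _ _ _.
  clearbody Sk St D Sx Sxx.
  move: (L / _) (norm2 z) rho0 n0 => rho n rho0 n0 S0 Sk0 dot.
  (* N is chosen for this completion of the square: B^2 T^2 pays for the drift 2 B |z|, and 4T beats
     the 3 from half the Laplacian with a margin of 1. *)
  have quad : 1 <= 2 * D - 3 + T^-1 * (N + n ^+ 2).
    have -> : T^-1 * (N + n ^+ 2) = 4 + 2 * (B * n) + (n - B * T) ^+ 2 / T.
      by rewrite /N; field; rewrite gt_eqF.
    have : 0 <= (n - B * T) ^+ 2 / T by rewrite divr_ge0 ?sqr_ge0// ltW.
    lra.
  have TSk : 0 <= T^-1 * Sk by rewrite mulr_ge0// invr_ge0 ltW.
  have rN : 0 <= rho * (N + n ^+ 2) by rewrite mulr_ge0// addr_ge0// sqr_ge0.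
  have : 0 < eps * (2 * D - 3 + T^-1 * (N + n ^+ 2) + rho * (N + n ^+ 2)).
    by rewrite mulr_gt0//; lra.
  lra.
- move=> z s zr /andP[s0 sT] [s00|[i zi]].
    rewrite s00 /th sqrtr0 mulr0 mul0r addr0 oppr0 expR0 mul1r.
    apply: le_trans (init z zr) _; rewrite /U lerD2r ler_wpM2l ?(ltW e0)//.
    by rewrite lerDl sqr_ge0.
  (* On a lateral face |z| >= |z_i| = r, and e^{-th} <= 1. *)
  apply: le_trans (Uge z s).
  apply: le_trans (_ : norm2 (w z s) <= _).
    rewrite ler_piMl ?norm2_ge0// -expR0 ler_expR oppr_le0; exact: th0.
  apply: le_trans (wM z s _) _; first by rewrite s0.
  rewrite ler_wpM2l ?(ltW e0)// -zi; apply: le_trans (_ : norm2 z ^+ 2 <= _).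
    by rewrite ler_pXn2r ?nnegrE ?norm2_ge0 ?normr_ge0// coord_le_norm2.
  by rewrite lerDr.
Qed.

End Superposition.

(** * Conclusion *)

Section Final.
Context {R : realType}.

(** Continuity of the datum is read off the solution, by slicing a product neighbourhood at time
    0. *)
Lemma continuous_initial (b w : 'rV[R]_3 -> R -> 'rV[R]_3) w0 :
  periodic_solution b w0 w -> continuous (fun x => norm2 (w x 0)).
Proof.
move=> sol x; have := within_continuous_norm2_solution _ _ _ sol.
move=> /subspace_continuousP /(_ (x, 0)) /= /(_ (lexx 0)) wc.
move=> A /wc [[A1 A2] /= [xA1 zA2] sub].
move: xA1; apply: filterS => z zA1; apply: (sub (z, 0)) => /=.
  by split=> //=; exact: nbhs_singleton.
exact: lexx.
Qed.

Lemma corner_le (r h : R) n (i : 'I_n * ('I_n * 'I_n)) k : 0 < h -> 0 <= r ->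
  h * n%:R <= 2 * r + h -> `|vec3 (corner r h n i) 0 k| <= r.
Proof.
move=> h0 r0 hn.
have le (j : 'I_n) : `|h * j%:R - r| <= r.
  have : h * (j%:R + 1) <= h * n%:R by rewrite ler_pM2l// natr1 ler_nat ltn_ord.
  have : 0 <= h * j%:R by rewrite mulr_ge0// ltW.
  by rewrite mulrDr mulr1 ler_norml => ? ?; apply/andP; split; lra.
case: i => [i1 [i2 i3]]; rewrite mxE (tnth_nth 0).
by case: k => [[|[|[|//]]] km] /=; exact: le.
Qed.

Lemma gauss_ge0 (t : R) (x : 'rV[R]_3) : 0 <= gauss t x.
Proof. by rewrite mulr_ge0 ?powR_ge0 ?expR_ge0. Qed.

Lemma riemann_sum_le_gauss_conv (f : 'rV[R]_3 -> R) (t r h : R) n x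
    (c : 'I_n * ('I_n * 'I_n) -> R) : 0 < h ->
  (forall y, 0 <= f y) -> (forall i, 0 <= c i) ->
  (forall i p, cell r h n i p -> c i <= f (vec3 p) * gauss t (x - vec3 p)) ->
  ((\sum_i c i * h ^+ 3)%:E <= gauss_conv t f x)%E.
Proof.
move=> h0 f0 c0 cf.
have := @lower_sum_le_integral _ _ R (lebesgue_measure \x lebesgue_plane)%E _
  (cell r h n) c (fun p => f (vec3 p) * gauss t (x - vec3 p))
  (measurable_cell r h n) (cell_inj r h n h0) c0
  (fun p => mulr_ge0 (f0 _) (gauss_ge0 _ _)) cf.
apply: le_trans; rewrite -sumEFin; apply: lee_sum => i _.
by rewrite EFinM lee_wpmul2l ?lee_fin// -(volume_cell r h n h0 i) lexx.
Qed.

Lemma gauss_conv_ge0 (f : 'rV[R]_3 -> R) (t : R) x :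
  (forall y, 0 <= f y) -> (0 <= gauss_conv t f x)%E.
Proof.
move=> f0; have F0 (p : R * (R * R)) : [set: R * (R * R)] p ->
    (0 <= (f (vec3 p) * gauss t (x - vec3 p))%:E)%E.
  by rewrite lee_fin mulr_ge0 ?gauss_ge0.
exact: (@integral_ge0 _ _ R (lebesgue_measure \x lebesgue_plane)%E setT _ F0).
Qed.

(** Box, mesh and coefficients are chosen after eps and vanish from the conclusion; [C] and [E] are
    free of eps, which may then tend to 0. *)
Lemma vorticity_bound_up_to_eps (b w : 'rV[R]_3 -> R -> 'rV[R]_3) (w0 : 'rV[R]_3 -> 'rV[R]_3)
    (kappa beta T B K eps : R) x :
  let N := 4 * T + B ^+ 2 * T ^+ 2 in
  let C := expR (3 / 2) * expR (3 / 2 + 3 / 2 * ln (2 * pi * beta)) in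
  let E := expR (2 * (K + rate kappa T B) * Num.sqrt T + 1) in
  0 < kappa -> (1 + kappa) * (1 + 2 * kappa) <= beta -> 0 < T -> 0 < eps ->
  periodic_solution b w0 w ->
  (forall (x : 'rV[R]_3) (s : R), 0 <= s <= T -> norm2 (b x s) <= B) ->
  (forall (x : 'rV[R]_3) (s : R), 0 <= s <= T ->
    Num.sqrt s * opnorm (gradient_matrix (b^~ s) x) <= K) ->
  ((norm2 (w x T))%:E <= (C * E)%:E * gauss_conv (beta * T) (fun y => norm2 (w0 y)) x
     + (E * (eps * (N + norm2 x ^+ 2)))%:E)%E.
Proof.
move=> N C E k0 kb T0 e0 sol bB AK.
have [_ wper w00 _] := sol.
have [M M0 wM] : exists2 M, 0 <= M &
    forall (x : 'rV[R]_3) (s : R), 0 <= s <= T -> norm2 (w x s) <= M.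
  have [||y [s [_ sM]]] := @periodic_bound_attained R (fun x s => norm2 (w x s)) T (ltW T0).
  - exact: within_continuous_norm2_solution sol.
  - by move=> s s0 i y; rewrite wper.
  by exists (norm2 (w y s)); [exact: norm2_ge0|].
have Me : 0 <= M / eps by rewrite divr_ge0 ?(ltW e0).
(* The box must contain x, and r >= max(1, M/eps) gives M <= eps r <= eps r^2. *)
pose r := norm2 x + M / eps + 1.
have r1 : 1 <= r by have := norm2_ge0 x; rewrite /r; lra.
have xr k : `|x 0 k| <= r by have := coord_le_norm2 x k; rewrite /r; lra.
have Mr : M <= eps * r ^+ 2.
  rewrite -ler_pdivrMl// mulrC; apply: le_trans (_ : r <= _).
    by have := norm2_ge0 x; rewrite /r; lra.
  by rewrite expr2 ler_peMr//; lra.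
have N0 : 0 < N.
  by rewrite /N; have := sqr_ge0 (B * T); rewrite exprMn; lra.
pose f y := norm2 (w0 y).
have fE : f = (fun y => norm2 (w y 0)) by apply/funext => y; rewrite w00.
have fc : continuous f by rewrite fE; exact: continuous_initial sol.
(* The slack eps N at time 0 is spent in two halves: one for the oscillation of f on a cell, one for
   lowering f(y i) to [m i]. *)
pose e1 := eps * N / 2.
have e10 : 0 < e1 by rewrite divr_gt0// mulr_gt0.
(* Cells may protrude from the box by at most h <= 1, hence r + 1. *)
have [d d0 fd] := compact_heine f (r + 1) e1 fc e10.
have kT0 : 0 < kappa * T by rewrite mulr_gt0.
have [h [h0 h1 hd hT]] : exists h, [/\ 0 < h, h <= 1, h <= d & h ^+ 2 <= kappa * T].
  exists (Num.min (Num.min 1 d) (Num.sqrt (kappa * T))); split.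
  - by rewrite !lt_min ltr01 d0 sqrtr_gt0.
  - by rewrite !ge_min lexx.
  - by rewrite !ge_min lexx orbT.
  rewrite -[leRHS](sqr_sqrtr (ltW kT0)) ler_pXn2r ?nnegrE ?sqrtr_ge0//.
    by rewrite ge_min lexx orbT.
  by rewrite !le_min ler01 (ltW d0) sqrtr_ge0.
pose n := (Num.truncn (2 * r / h)).+1.
have q0 : 0 <= 2 * r / h by rewrite divr_ge0 ?(ltW h0)//; lra.
have [hn1 hn2] : 2 * r < h * n%:R /\ h * n%:R <= 2 * r + h.
  have := truncn_itv q0; rewrite ler_pdivlMr// ltr_pdivrMr// /n -[(Num.truncn _).+1%:R]natr1.
  by move: (Num.truncn _)%:R => a /andP[? ?]; split; lra.
pose y i := vec3 (corner r h n i).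
have yr i k : `|y i 0 k| <= r by apply: corner_le => //; lra.
have cell_box i p k : cell r h n i p -> `|vec3 p 0 k| <= r + 1.
  move=> /(cell_dist r h n i p k) pd; have := yr i k; rewrite /y.
  by move: pd; rewrite !ler_norml => /andP[? ?] /andP[? ?]; apply/andP; split; lra.
have fcell i p : cell r h n i p -> `|f (vec3 p) - f (y i)| < e1.
  move=> ip; apply: fd => k; first exact: cell_box ip.
    by apply: le_trans (yr i k) _; lra.
  by apply: le_trans (cell_dist r h n i p k ip) hd.
(* A lower bound of f on the whole cell, so that a lower Riemann sum results; the truncation at 0
   keeps the coefficients nonnegative. *)
pose m i := Num.max 0 (f (y i) - e1).
have m0 i : 0 <= m i by rewrite le_max lexx.
have mle i p : cell r h n i p -> m i <= f (vec3 p).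
  move=> /fcell; rewrite ltr_norml => /andP[? ?].
  by rewrite ge_max norm2_ge0 /=; lra.
pose c i := expR (3 / 2) * h ^+ 3 * m i.
have c0 i : 0 <= c i by rewrite mulr_ge0// mulr_ge0 ?expR_ge0// exprn_ge0// ltW.
have bound := @superposition_bound R b w w0 kappa T h B K eps r _ c y k0 T0 h0 e0
  (le_trans ler01 r1) sol bB AK (fun x s sT => le_trans (wM x s sT) Mr) c0.
have init (z : 'rV[R]_3) : (forall k, `|z 0 k| <= r) -> norm2 (w z 0) <=
    eps * N + \sum_i c i * kernel (h ^+ 2) kappa T (y i) z 0.
  move=> zr; have [p zp [i ip]] := @cell_cover R r h n h0 z hn1 zr.
  have ci : m i <= c i * kernel (h ^+ 2) kappa T (y i) z 0.
    rewrite /c mulrAC ler_peMl//; apply: kernel_start => // k.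
    by rewrite !mxE zp; have := cell_dist r h n i p k ip; rewrite /y !mxE.
  apply: le_trans (_ : eps * N + m i <= _).
    have NE : eps * N = e1 + e1 by rewrite /e1; field.
    have := fcell i p ip; rewrite -zp ltr_norml => /andP[_ fz].
    have fm : f (y i) - e1 <= m i by rewrite le_max lexx orbT.
    by have -> : norm2 (w z 0) = f z by [rewrite fE]; lra.
  rewrite lerD2l; apply: le_trans ci _; rewrite [leRHS](bigD1 i)//= lerDl sumr_ge0// => j _.
  by rewrite mulr_ge0// ltW// kernel_gt0.
have := bound init x xr; rewrite -/N -/E => wx.
pose C3 := expR (3 / 2 + 3 / 2 * ln (2 * pi * beta)).
have C30 : 0 < C3 by exact: expR_gt0.
(* By [kernel_end] this value lies below f(z) G_{beta T}(x - z) for every z in cell i. *)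
pose c' i := m i * kernel (h ^+ 2) kappa T (y i) x T / C3.
have c'0 i : 0 <= c' i.
  by rewrite divr_ge0 ?(ltW C30)// mulr_ge0// ltW// kernel_gt0.
have conv : ((\sum_i c' i * h ^+ 3)%:E <= gauss_conv (beta * T) f x)%E.
  apply: (@riemann_sum_le_gauss_conv f (beta * T) r h n x c') => //.
    by move=> z; exact: norm2_ge0.
  move=> i p ip; rewrite ler_pdivrMr// -mulrA; apply: ler_pM => //.
  - by rewrite ltW// kernel_gt0.
  - exact: mle.
  rewrite mulrC; apply: kernel_end => // k.
  by have := cell_dist r h n i p k ip; rewrite /y !mxE.
have sumE : \sum_i c i * kernel (h ^+ 2) kappa T (y i) x T = C * \sum_i c' i * h ^+ 3.
  rewrite mulr_sumr; apply: eq_bigr => i _; rewrite /C /c /c' -/C3.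
  by field; rewrite gt_eqF.
have E0 : 0 < E by exact: expR_gt0.
apply: (@le_trans _ _ ((C * E) * (\sum_i c' i * h ^+ 3)
    + E * (eps * (N + norm2 x ^+ 2)))%:E).
  by rewrite lee_fin; apply: le_trans wx _; rewrite sumE; lra.
rewrite EFinD leeD2r// EFinM lee_wpmul2l// lee_fin.
by rewrite mulr_ge0 ?(ltW E0)// mulr_ge0 ?expR_ge0.
Qed.

End Final.

Theorem lemma6p2 (R : realType) (beta : R) (beta_gt1 : 1 < beta) :
  exists C1 C2 : R, [/\ 0 < C1, 0 < C2 &
    forall (u0 : 'rV[R]_3 -> 'rV[R]_3) (b w : 'rV[R]_3 -> R -> 'rV[R]_3),
      smooth_field u0 -> unit_periodic u0 -> (forall x, divergence u0 x = 0) ->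
      smooth_time_field b -> (forall t, 0 <= t -> unit_periodic (b^~ t)) ->
      (forall x t, 0 <= t -> divergence (b^~ t) x = 0) ->
      (forall x, b x 0 = u0 x) ->
      periodic_solution b (curl u0) w ->
      forall (t : R) (x : 'rV[R]_3), 0 < t ->
        ((norm2 (w x t))%:E <=
         C1%:E * expeR ((C2 * t)%:E * sup_norm b ^+ 2
                        + (2 * Num.sqrt t)%:E * weighted_grad_norm b t)
         * gauss_conv (beta * t) (fun y => norm2 (curl u0 y)) x)%E].
Proof.
have [kappa k0 kb] : exists2 kappa : R, 0 < kappa &
    (1 + kappa) * (1 + 2 * kappa) <= beta.
  (* For 0 <= k <= 1 one has (1 + k)(1 + 2k) <= 1 + 5k. *)
  exists (Num.min 1 ((beta - 1) / 5)); first by rewrite lt_min ltr01 divr_gt0//; lra.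
  have : 0 <= Num.min 1 ((beta - 1) / 5) by rewrite le_min ler01 divr_ge0//; lra.
  have : Num.min 1 ((beta - 1) / 5) <= 1 by rewrite ge_min lexx.
  have : Num.min 1 ((beta - 1) / 5) <= (beta - 1) / 5 by rewrite ge_min lexx orbT.
  by move: (Num.min _ _) => k; nra.
pose C0 := expR (3 / 2) * expR (3 / 2 + 3 / 2 * ln (2 * pi * beta)).
have C00 : 0 < C0 by rewrite mulr_gt0 ?expR_gt0.
(* Both come from 2 [rate] sqrt t = 9 kappa/2 + 2 B^2 t/(3 kappa): the part without B joins the
   constant, the rest gives the exponent. *)
exists (C0 * expR (9 / 2 * kappa + 1)), (2 / (3 * kappa)); split.
- by rewrite mulr_gt0 ?expR_gt0.
- by rewrite divr_gt0// mulr_gt0.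
move=> u0 b w _ _ _ bsm bper _ _ sol t x t0.
have [B [bB Bsup]] := drift_bound b bsm bper t (ltW t0).
have [K [AK Ksup]] := gradient_bound b bsm bper t (ltW t0).
have B0 : 0 <= B by have := bB 0 0; rewrite lexx ltW// => /(_ isT); exact/le_trans/norm2_ge0.
have conv0 : (0 <= gauss_conv (beta * t) (fun y => norm2 (curl u0 y)) x)%E.
  by apply: gauss_conv_ge0 => y; exact: norm2_ge0.
set conv := gauss_conv _ _ _ in conv0 *.
set E := expR (2 * (K + rate kappa t B) * Num.sqrt t + 1).
have step : ((norm2 (w x t))%:E <= (C0 * E)%:E * conv)%E.
  apply/lee_addgt0Pr => eps eps0.
  pose N := 4 * t + B ^+ 2 * t ^+ 2.
  have N0 : 0 < N + norm2 x ^+ 2.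
    rewrite ltr_wpDr ?sqr_ge0//.
    by rewrite /N; have := sqr_ge0 (B * t); rewrite exprMn; lra.
  have E0 : 0 < E by exact: expR_gt0.
  (* With this parameter the error term equals eps exactly. *)
  have e0 : 0 < eps / (E * (N + norm2 x ^+ 2)) by rewrite divr_gt0// mulr_gt0.
  have := @vorticity_bound_up_to_eps R b w _ kappa beta t B K _ x k0 kb t0 e0 sol bB AK.
  rewrite -/C0 -/E -/N -/conv; congr (_ <= _ + _%:E)%E.
  by field; rewrite !gt_eqF.
apply: le_trans step _; rewrite lee_wpmul2r//.
have EE : E = expR (9 / 2 * kappa + 1)
    * expR (2 / (3 * kappa) * t * B ^+ 2 + 2 * Num.sqrt t * K).
  rewrite /E -expRD; congr expR; rewrite /rate.
  have := sqr_sqrtr (ltW t0); have : 0 < Num.sqrt t by rewrite sqrtr_gt0.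
  move: (Num.sqrt t) => q q0 tq; rewrite -[X in _ * X * B ^+ 2]tq.
  by field; rewrite !gt_eqF.
rewrite EE mulrA EFinM lee_wpmul2l//.
  by rewrite lee_fin mulr_ge0 ?expR_ge0// ltW.
(* Passing to the extended exponential lets monotonicity replace B and K by the norms, including an
   infinite [sup_norm b]. *)
rewrite -[leLHS]/(expeR (2 / (3 * kappa) * t * B ^+ 2 + 2 * Num.sqrt t * K)%:E).
rewrite lee_expeR EFinD leeD// EFinM lee_wpmul2l//.
- by rewrite lee_fin mulr_ge0// ?divr_ge0 ?mulr_ge0// ltW.
- by rewrite expe2 expr2 EFinM lee_pmul// lee_fin.
Qed.
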